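(* Let $\rho=(r_n)_n$ be an increasing sequence in $[0,1)$ with $r_n\to 1$. Let $w:[0,1)\to[1,\infty)$ be continuous and increasing with $w(r)\to\infty$ as $r\to1$. For any $A\subset\mathbb{D}$ such that $\overline{A}\cap\mathbb{T}$ contains exactly one point, there exists $f\in\mathcal{U}_A(\mathbb{D},\rho)$ such that $|f(z)|\le w(|z|)$ for all $z\in A$.
   Context: $\mathbb{D}$ is the open unit disc, $\mathbb{T}$ the unit circle. For $f\in H(\mathbb{D})$, $f_r(z):=f(rz)$; $\mathcal{U}_A(\mathbb{D},\rho)$ is the set of $f\in H(\mathbb{D})$ such that for every compact $K\subset\mathbb{T}$, $K\neq\mathbb{T}$, and every continuous $\varphi$ on $K$ there is an increasing sequence $(n_k)$ with $\sup_{\zeta\in K}|f_{r_{n_k}}(\zeta)-\varphi(\zeta)|\to0$. *)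

(* Defs.v *)
From Stdlib Require Import Reals List.
From Coquelicot Require Import Coquelicot.
Open Scope R_scope.

Definition unit_disc (z : C) : Prop := Cmod z < 1.
Definition unit_circle (z : C) : Prop := Cmod z = 1.

Definition holo_disc (f : C -> C) : Prop :=
  forall z : C, unit_disc z -> ex_derive (K := C_AbsRing) (V := C_NormedModule) f z.

Definition closureC (A : C -> Prop) (z : C) : Prop :=
  forall eps : R, 0 < eps -> exists a : C, A a /\ Cmod (a - z) < eps.

Definition compactC (K : C -> Prop) : Prop :=
  forall (I : Type) (U : I -> C -> Prop),
    (forall i, open (U i)) ->
    (forall z, K z -> exists i, U i z) ->
    exists l : list I, forall z, K z -> exists i, In i l /\ U i z.

Definition continuous_onC (K : C -> Prop) (phi : C -> C) : Prop :=
  forall z, K z -> filterlim phi (within K (locally z)) (locally (phi z)).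

Definition dilate (f : C -> C) (r : R) : C -> C := fun z => f (RtoC r * z)%C.

Definition U_A (rho : nat -> R) (f : C -> C) : Prop :=
  holo_disc f /\
  forall (K : C -> Prop) (phi : C -> C),
    compactC K ->
    (forall z, K z -> unit_circle z) ->
    (exists z, unit_circle z /\ ~ K z) ->
    continuous_onC K phi ->
    exists nk : nat -> nat,
      (forall k, (nk k < nk (S k))%nat) /\
      forall eps : R, 0 < eps -> exists k0 : nat, forall k : nat, (k0 <= k)%nat ->
        forall z, K z -> Cmod (dilate f (rho (nk k)) z - phi z) <= eps.

(* Main.v *)
Require Import Defs.
From Stdlib Require Import Reals.
From Coquelicot Require Import Coquelicot.
From Stdlib Require Import Lra Lia List IndefiniteDescription Cantor.
Open Scope R_scope.

(* Near the circle the set [A] lies in an arbitrarily small neighbourhood of its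
   accumulation point [zeta0].  The function is a series of polynomials.  Given the current
   partial sum [S], a radius [s] at which [w] exceeds all bounds met in this step, and a
   target on the circle with value [c0] at [zeta0], the next term is [(c0 - S) W + Z], where
   [W] is nearly 0 on [|z| <= s], nearly 1 on the circle [|z| = r] off a gap, and bounded by
   about 1 on [A], and [Z] corrects the target away from [zeta0].  Near [zeta0] the power
   [(z / zeta0) ^ N] serves as [W]: it is small on [|z| <= s], and nearly 1 on a
   neighbourhood of [zeta0] which contains [A] beyond some radius [s' < r].  Away from
   [zeta0] there are no points of [A] beyond [s'], and averages of Poisson kernels, written
   as differences of simple poles on both sides of [|z| = r], do the rest; the inner poles
   are pushed out of the disc through the gap, so that polynomials approximate these
   averages uniformly on all the sets involved. *)

(** By the maximum principle no polynomial is small on [|z| <= s] and close to 1 on all of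
    [|z| = r]. Hence every target leaves out a gap, which is available because a compact set other
    than the whole circle misses a point. The rate of growth of [w] is irrelevant because of the
    order of choices: the bound of a new term on [A] depends only on the earlier terms and on the
    target, so it is known before the radius beyond which [w] exceeds it is selected. Within a step,
    the exponent [N] is chosen first, then the size of the cap at [zeta0] in terms of [N], then
    [s'], and [r] last. [A] may approach [zeta0] in any manner, and a kernel average has
    uncontrolled values near its inner poles; the power has modulus at most 1 on the whole disc,
    which is why it takes over there. It can do so because a single constant [c0] serves the single
    accumulation point. Integrals are replaced by finite averages over roots of unity, and supremum
    norms by coefficient norms. *)

Lemma Cmod_minus_sym (x y : C) : Cmod (x - y) = Cmod (y - x).
Proof. replace (x - y)%C with (- (y - x))%C by ring. apply Cmod_opp. Qed.

Lemma Cmod_triangle_mid (y x z : C) : Cmod (x - z) <= Cmod (x - y) + Cmod (y - z).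
Proof. replace (x - z)%C with ((x - y) + (y - z))%C by ring. apply Cmod_triangle. Qed.

Lemma Cmod_minus_triangle (x y : C) : Cmod (x - y) <= Cmod x + Cmod y.
Proof. unfold Cminus. rewrite <- (Cmod_opp y). apply Cmod_triangle. Qed.

Lemma Cmod_triangle_rev (x y : C) : Cmod x - Cmod y <= Cmod (x - y).
Proof.
  assert (H := Cmod_triangle (x - y) y).
  replace (x - y + y)%C with x in H by ring. lra.
Qed.

Lemma Cmod_scal_R (a : R) (z : C) : 0 <= a -> Cmod (RtoC a * z) = a * Cmod z.
Proof. intros Ha. rewrite Cmod_mult, Cmod_R, Rabs_pos_eq; trivial. Qed.

Lemma Cmod_neq_0 (z : C) : 0 < Cmod z -> z <> 0%C.
Proof. intros H. apply Cmod_gt_0. exact H. Qed.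

Lemma Cmod_1_conj (z : C) : Cmod z = 1 -> (z * Cconj z = 1)%C.
Proof. intros H. rewrite <- Cmod2_conj, H. apply f_equal. ring. Qed.

Lemma Cmod_one_minus (y : C) : 1 - Cmod y <= Cmod (1 - y).
Proof. assert (H := Cmod_triangle_rev 1 y). rewrite Cmod_1 in H. exact H. Qed.

(** Rescaling [t * a] to modulus [s] moves it by [|s - t|], a difference of moduli and so at most
    the distance on the right; hence the factor 2. This turns separated directions into separated
    points, whatever the radii. *)
Lemma unit_dist_scal (a b : C) (s t : R) :
  Cmod a = 1 -> Cmod b = 1 -> 0 <= s -> 0 <= t ->
  s * Cmod (a - b) <= 2 * Cmod (RtoC t * a - RtoC s * b).
Proof.
  intros Ha Hb Hs Ht.
  rewrite <- (Cmod_scal_R s (a - b) Hs).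
  assert (H1 := Cmod_triangle_mid (RtoC t * a) (RtoC s * a) (RtoC s * b)).
  replace (RtoC s * (a - b))%C with (RtoC s * a - RtoC s * b)%C by ring.
  assert (H2 : Cmod (RtoC s * a - RtoC t * a) = Rabs (s - t)).
  { replace (RtoC s * a - RtoC t * a)%C with (RtoC (s - t) * a)%C
      by (rewrite RtoC_minus; ring).
    rewrite Cmod_mult, Cmod_R, Ha. ring. }
  assert (H3 := Cmod_triangle_rev (RtoC t * a) (RtoC s * b)).
  assert (H4 := Cmod_triangle_rev (RtoC s * b) (RtoC t * a)).
  rewrite (Cmod_minus_sym (RtoC s * b)) in H4.
  rewrite !Cmod_scal_R, Ha, Hb in H3, H4 by assumption.
  revert H2. unfold Rabs. destruct (Rcase_abs (s - t)); intros; lra.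
Qed.

(** * Finite sums and roots of unity *)

Fixpoint csum (n : nat) (f : nat -> C) : C :=
  match n with O => 0%C | S m => (csum m f + f m)%C end.

Fixpoint rsum (n : nat) (f : nat -> R) : R :=
  match n with O => 0 | S m => rsum m f + f m end.

Lemma csum_ext n f g : (forall k, (k < n)%nat -> f k = g k) -> csum n f = csum n g.
Proof.
  induction n as [|n IH]; intros H; simpl; trivial.
  rewrite IH, (H n); auto with arith.
Qed.

Lemma csum_plus n f g : csum n (fun k => f k + g k)%C = (csum n f + csum n g)%C.
Proof. induction n as [|n IH]; simpl; [ring|]. rewrite IH. ring. Qed.

Lemma csum_scal n a f : csum n (fun k => a * f k)%C = (a * csum n f)%C.
Proof. induction n as [|n IH]; simpl; [ring|]. rewrite IH. ring. Qed.

Lemma csum_swap n m (f : nat -> nat -> C) :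
  csum n (fun i => csum m (f i)) = csum m (fun j => csum n (fun i => f i j)).
Proof.
  induction n as [|n IH]; simpl.
  - induction m as [|m IHm]; simpl; trivial. rewrite <- IHm. ring.
  - rewrite IH, csum_plus. reflexivity.
Qed.

Lemma csum_1 n : csum n (fun _ => 1%C) = RtoC (INR n).
Proof.
  induction n as [|n IH]; [reflexivity|].
  rewrite S_INR, RtoC_plus, <- IH. reflexivity.
Qed.

Lemma csum_geom n y : ((1 - y) * csum n (fun k => y ^ k) = 1 - y ^ n)%C.
Proof.
  induction n as [|n IH]; [simpl; ring|].
  rewrite Cpow_S. simpl. rewrite Cmult_plus_distr_l, IH. ring.
Qed.

Lemma csum_single n (f : nat -> C) i : (i < n)%nat ->
  (forall k, (k < n)%nat -> k <> i -> f k = 0%C) -> csum n f = f i.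
Proof.
  intros Hi. induction n as [|n IH]; intros H; [lia|]. simpl.
  destruct (Nat.eq_dec i n) as [->|Hne].
  - rewrite (csum_ext n f (fun _ => 0 * 1)%C).
    + rewrite csum_scal. ring.
    + intros k Hk. rewrite H by lia. ring.
  - rewrite IH by (try lia; intros; apply H; lia). rewrite (H n) by lia. ring.
Qed.

Lemma csum_Re n f : Re (csum n f) = rsum n (fun k => Re (f k)).
Proof. induction n as [|n IH]; simpl; trivial. rewrite <- IH. reflexivity. Qed.

Lemma csum_RtoC n f : csum n (fun k => RtoC (f k)) = RtoC (rsum n f).
Proof. induction n as [|n IH]; simpl; trivial. rewrite IH, RtoC_plus. reflexivity. Qed.

Lemma Cmod_csum n f : Cmod (csum n f) <= rsum n (fun k => Cmod (f k)).
Proof.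
  induction n as [|n IH]; simpl; [rewrite Cmod_0; lra|].
  eapply Rle_trans; [apply Cmod_triangle|]. lra.
Qed.

Lemma rsum_le n f g : (forall k, (k < n)%nat -> f k <= g k) -> rsum n f <= rsum n g.
Proof.
  induction n as [|n IH]; intros H; simpl; [lra|].
  apply Rplus_le_compat; [apply IH; intros|]; apply H; lia.
Qed.

Lemma rsum_ext n f g : (forall k, (k < n)%nat -> f k = g k) -> rsum n f = rsum n g.
Proof. intros H. apply Rle_antisym; apply rsum_le; intros k Hk; rewrite (H k Hk); lra. Qed.

Lemma rsum_const n c : rsum n (fun _ => c) = INR n * c.
Proof. induction n as [|n IH]; [simpl; ring|]. rewrite S_INR. simpl. rewrite IH. ring. Qed.

Lemma rsum_plus n f g : rsum n (fun k => f k + g k) = rsum n f + rsum n g.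
Proof. induction n as [|n IH]; simpl; [ring|]. rewrite IH. ring. Qed.

Lemma rsum_scal n a f : rsum n (fun k => a * f k) = a * rsum n f.
Proof. induction n as [|n IH]; simpl; [ring|]. rewrite IH. ring. Qed.

(** * Points of the circle by their angle *)

Definition cis (t : R) : C := (cos t, sin t).

Lemma cis_plus a b : cis (a + b) = (cis a * cis b)%C.
Proof. unfold cis, Cmult; simpl. rewrite cos_plus, sin_plus. f_equal; ring. Qed.

Lemma cis_0 : cis 0 = 1%C.
Proof. unfold cis. rewrite cos_0, sin_0. reflexivity. Qed.

Lemma Cmod_cis t : Cmod (cis t) = 1.
Proof.
  unfold Cmod, cis; simpl fst; simpl snd. rewrite <- sqrt_1. apply f_equal.
  transitivity (Rsqr (sin t) + Rsqr (cos t)); [unfold Rsqr; ring|apply sin2_cos2].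
Qed.

Lemma cis_pow t n : (cis t ^ n)%C = cis (INR n * t).
Proof.
  induction n as [|n IH]; [simpl; rewrite Rmult_0_l, cis_0; reflexivity|].
  rewrite Cpow_S, IH, <- cis_plus. f_equal. rewrite S_INR. ring.
Qed.

Lemma cis_2PI n : cis (INR n * (2 * PI)) = 1%C.
Proof.
  rewrite <- cis_pow. unfold cis. rewrite cos_2PI, sin_2PI. apply Cpow_1_l.
Qed.

Lemma chord_sq a b : Cmod (cis a - cis b) ^ 2 = 4 * (sin ((a - b) / 2)) ^ 2.
Proof.
  rewrite Cmod2_alt. change (Re (cis a - cis b)) with (cos a - cos b).
  change (Im (cis a - cis b)) with (sin a - sin b).
  assert (E : cos (a - b) = 1 - 2 * (sin ((a - b) / 2)) ^ 2).
  { replace (a - b) with (2 * ((a - b) / 2)) at 1 by field.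
    rewrite cos_2a_sin. ring. }
  rewrite cos_minus in E.
  assert (Ha := sin2_cos2 a). assert (Hb := sin2_cos2 b). unfold Rsqr in *.
  transitivity ((sin a * sin a + cos a * cos a) + (sin b * sin b + cos b * cos b)
                - 2 * (cos a * cos b + sin a * sin b)); [ring|].
  rewrite Ha, Hb, E. ring.
Qed.

Lemma cis_lipschitz a b : Cmod (cis a - cis b) <= Rabs (a - b).
Proof.
  apply Rsqr_incr_0; [|apply Cmod_ge_0|apply Rabs_pos].
  rewrite <- Rsqr_abs, !Rsqr_pow2, chord_sq.
  assert (H : Rabs (sin ((a - b) / 2)) <= Rabs ((a - b) / 2)).
  { set (x := (a - b) / 2).
    assert (P : forall y, 0 <= y -> Rabs (sin y) <= y).
    { intros y Hy. destruct (Req_dec y 0) as [->|H0].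
      - rewrite sin_0, Rabs_R0. lra.
      - apply Rabs_le. assert (H1 := sin_lt_x y). assert (H2 := SIN_bound y).
        split; [|lra]. destruct (Rle_dec y 1).
        + assert (0 <= sin y). { apply sin_ge_0; try lra. assert (H := PI2_1). lra. } lra.
        + lra. }
    destruct (Rle_dec 0 x).
    - rewrite (Rabs_pos_eq x) by lra. apply P; lra.
    - rewrite <- Rabs_Ropp, <- (Rabs_Ropp x), <- sin_neg, (Rabs_pos_eq (- x)) by lra.
      apply P; lra. }
  apply Rsqr_le_abs_1 in H. rewrite !Rsqr_pow2 in H. nra.
Qed.

Lemma chord_from_0 t : 0 <= t <= 2 * PI -> Cmod (cis t - 1) = 2 * sin (t / 2).
Proof.
  intros Ht. apply Rsqr_inj; [apply Cmod_ge_0| |].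
  - assert (0 <= sin (t / 2)) by (apply sin_ge_0; lra). lra.
  - rewrite <- cis_0, !Rsqr_pow2, chord_sq, Rminus_0_r. ring.
Qed.

(** The distance to 1 increases up to the angle [PI] and decreases afterwards, so on an arc of
    angles in [[0, 2 * PI]] it is smallest at an end. *)
Lemma chord_between (b t a : R) : 0 <= b <= t -> t <= a <= 2 * PI ->
  Rmin (Cmod (cis b - 1)) (Cmod (cis a - 1)) <= Cmod (cis t - 1).
Proof.
  intros Hb Ha. rewrite !chord_from_0 by lra.
  destruct (Rle_dec t PI) as [H|H].
  - eapply Rle_trans; [apply Rmin_l|].
    apply Rmult_le_compat_l; [lra|]. apply sin_incr_1; lra.
  - eapply Rle_trans; [apply Rmin_r|].
    apply Rmult_le_compat_l; [lra|]. apply sin_decr_1; lra.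
Qed.

Lemma cis_neq_1 t : 0 < t < 2 * PI -> cis t <> 1%C.
Proof.
  intros Ht E. assert (H := chord_from_0 t ltac:(lra)).
  rewrite E in H. replace (1 - 1)%C with (RtoC 0) in H by ring.
  rewrite Cmod_0 in H. assert (0 < sin (t / 2)) by (apply sin_gt_0; lra). lra.
Qed.

Lemma arg_exists (z : C) : Cmod z = 1 -> exists t, 0 <= t < 2 * PI /\ z = cis t.
Proof.
  intros H.
  assert (H2 : Re z ^ 2 + Im z ^ 2 = 1) by (rewrite <- Cmod2_alt, H; ring).
  destruct z as [x y]; simpl in H2.
  assert (Hx : -1 <= x <= 1) by nra.
  assert (Hb := acos_bound x). assert (Hp := PI_RGT_0).
  assert (Hs : sin (acos x) = Rabs y).
  { rewrite sin_acos by lra. rewrite <- sqrt_Rsqr_abs. f_equal. unfold Rsqr. lra. }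
  destruct (Rle_dec 0 y) as [Hy|Hy].
  - exists (acos x). split; [lra|]. unfold cis. rewrite cos_acos, Hs, Rabs_pos_eq; auto.
  - exists (2 * PI - acos x). split.
    + split; [lra|]. destruct (Req_dec (acos x) 0) as [E|E]; [|lra].
      rewrite E, sin_0 in Hs. symmetry in Hs. apply Rabs_eq_0 in Hs. lra.
    + unfold cis. rewrite cos_minus, sin_minus, cos_2PI, sin_2PI, cos_acos, Hs by lra.
      rewrite Rabs_left by lra. f_equal; ring.
Qed.

Definition root (n k : nat) : C := cis (INR k * (2 * PI / INR n)).

Lemma Cmod_root n k : Cmod (root n k) = 1.
Proof. apply Cmod_cis. Qed.

Lemma root_pow_swap n k m : (root n k ^ m)%C = (root n m ^ k)%C.
Proof. unfold root. rewrite !cis_pow. f_equal. ring. Qed.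

Lemma root_pow_n n k : (0 < n)%nat -> (root n k ^ n)%C = 1%C.
Proof.
  intros Hn. unfold root. rewrite cis_pow.
  replace (INR n * (INR k * (2 * PI / INR n))) with (INR k * (2 * PI)).
  - apply cis_2PI.
  - field. apply not_0_INR. lia.
Qed.

Lemma root_neq_1 n k : (0 < k < n)%nat -> root n k <> 1%C.
Proof.
  intros H. apply cis_neq_1.
  assert (0 < INR k) by (apply lt_0_INR; lia).
  assert (INR k < INR n) by (apply lt_INR; lia).
  assert (Hp := PI_RGT_0). unfold Rdiv.
  split; [apply Rmult_lt_0_compat; trivial; apply Rmult_lt_0_compat; [lra|];
          apply Rinv_0_lt_compat; lra|].
  replace (INR k * (2 * PI * / INR n)) with (2 * PI * (INR k * / INR n)) by ring.
  rewrite <- (Rmult_1_r (2 * PI)) at 2. apply Rmult_lt_compat_l; [lra|].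
  apply (Rmult_lt_reg_r (INR n)); [lra|]. rewrite Rmult_assoc, Rinv_l; lra.
Qed.

(** Exchanging exponent and index makes this a geometric sum whose ratio [root n m] differs from 1
    while its [n]-th power is 1. *)
Lemma root_pow_sum n m : (0 < m < n)%nat -> csum n (fun k => root n k ^ m)%C = 0%C.
Proof.
  intros H. rewrite (csum_ext n _ (fun k => root n m ^ k)%C)
    by (intros; apply root_pow_swap).
  assert (G := csum_geom n (root n m)). rewrite root_pow_n in G by lia.
  replace (1 - 1)%C with (RtoC 0) in G by ring.
  assert (Hn : (1 - root n m)%C <> 0%C).
  { intros E. apply (root_neq_1 n m H).
    replace (root n m) with (1 - (1 - root n m))%C by ring. rewrite E. ring. }
  rewrite <- (Cmult_1_l (csum _ _)), <- (Cinv_l _ Hn), <- Cmult_assoc, G. ring.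
Qed.

Lemma one_minus_neq_0 y : Cmod y < 1 -> (1 - y)%C <> 0%C.
Proof. intros H. apply Cmod_neq_0. assert (G := Cmod_one_minus y). lra. Qed.

(** Multiplied by [1 - y ^ n], which is also [1 - (y * root n k) ^ n], each fraction becomes a
    finite geometric sum; summation over the roots then kills every power except the zeroth. *)
Lemma root_geom_sum n y : (0 < n)%nat -> Cmod y < 1 ->
  csum n (fun k => / (1 - y * root n k))%C = (RtoC (INR n) / (1 - y ^ n))%C.
Proof.
  intros Hn Hy.
  assert (Hyn : Cmod (y ^ n) < 1).
  { rewrite Cmod_pow. apply pow_lt_1_compat; [split; [apply Cmod_ge_0|lra]|lia]. }
  assert (E : csum n (fun k => (1 - y ^ n) * / (1 - y * root n k))%C = RtoC (INR n)).
  { rewrite (csum_ext n _ (fun k => csum n (fun m => y ^ m * root n k ^ m))%C).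
    - rewrite csum_swap.
      etransitivity; [apply (csum_single n _ 0 Hn)|].
      + intros m Hm H0. rewrite (csum_scal n (y ^ m)%C (fun i => root n i ^ m)%C).
        rewrite root_pow_sum by lia. ring.
      + rewrite <- csum_1. apply csum_ext. intros; simpl; ring.
    - intros k _.
      assert (Hk : (1 - y * root n k)%C <> 0%C).
      { apply one_minus_neq_0. rewrite Cmod_mult, Cmod_root. lra. }
      assert (G := csum_geom n (y * root n k)).
      rewrite Cpow_mult_l, root_pow_n, Cmult_1_r in G by trivial.
      rewrite <- G, Cmult_comm, Cmult_assoc, Cinv_l, Cmult_1_l by trivial.
      apply csum_ext. intros; apply Cpow_mult_l. }
  rewrite (csum_scal n (1 - y ^ n)%C) in E. apply one_minus_neq_0 in Hyn.
  rewrite <- E. field. exact Hyn.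
Qed.

(** * Polynomials as coefficient lists *)

Fixpoint peval (l : list C) (z : C) : C :=
  match l with nil => 0%C | c :: q => (c + z * peval q z)%C end.

Fixpoint pder (l : list C) (z : C) : C :=
  match l with nil => 0%C | c :: q => (peval q z + z * pder q z)%C end.

(** Unlike a supremum, this weighted coefficient norm bounds values, derivatives and Taylor
    remainders by induction on the list; [cauchy_estimate] leads back to it from a bound on a
    circle. *)
Fixpoint pnorm (s : R) (l : list C) : R :=
  match l with nil => 0 | c :: q => Cmod c + s * pnorm s q end.

Fixpoint padd (p q : list C) : list C :=
  match p, q with
  | nil, _ => q
  | _, nil => p
  | a :: p', b :: q' => (a + b)%C :: padd p' q'
  end.

Definition pscal (c : C) (p : list C) : list C := map (Cmult c) p.

Fixpoint pmul (p q : list C) : list C :=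
  match p with nil => nil | a :: p' => padd (pscal a q) (RtoC 0 :: pmul p' q) end.

Lemma peval_padd p q z : peval (padd p q) z = (peval p z + peval q z)%C.
Proof.
  revert q; induction p as [|a p IH]; intros [|b q]; simpl; try ring.
  rewrite IH. ring.
Qed.

Lemma pder_padd p q z : pder (padd p q) z = (pder p z + pder q z)%C.
Proof.
  revert q; induction p as [|a p IH]; intros [|b q]; simpl; try ring.
  rewrite IH, peval_padd. ring.
Qed.

Lemma peval_pscal c p z : peval (pscal c p) z = (c * peval p z)%C.
Proof. induction p as [|a p IH]; simpl; [ring|]. rewrite IH. ring. Qed.

Lemma peval_pmul p q z : peval (pmul p q) z = (peval p z * peval q z)%C.
Proof.
  induction p as [|a p IH]; simpl; [ring|].
  rewrite peval_padd, peval_pscal. simpl. rewrite IH. ring.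
Qed.

Lemma pnorm_ge_0 s l : 0 <= s -> 0 <= pnorm s l.
Proof.
  intros Hs. induction l as [|c l IH]; simpl; [lra|].
  assert (H := Cmod_ge_0 c). nra.
Qed.

Lemma Cmod_peval s l z : Cmod z <= s -> Cmod (peval l z) <= pnorm s l.
Proof.
  intros Hz. assert (Hz0 := Cmod_ge_0 z).
  induction l as [|c l IH]; simpl; [rewrite Cmod_0; lra|].
  eapply Rle_trans; [apply Cmod_triangle|]. rewrite Cmod_mult.
  apply Rplus_le_compat_l, Rmult_le_compat; trivial. apply Cmod_ge_0.
Qed.

Lemma Cmod_pder t s l z : Cmod z <= t -> t < s ->
  Cmod (pder l z) * (s - t) <= pnorm s l.
Proof.
  intros Hz Hts. assert (Hz0 := Cmod_ge_0 z).
  induction l as [|c l IH]; simpl; [rewrite Cmod_0; lra|].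
  assert (H1 := Cmod_triangle (peval l z) (z * pder l z)). rewrite Cmod_mult in H1.
  assert (H2 := Cmod_peval s l z ltac:(lra)).
  assert (H3 := Cmod_ge_0 c). assert (H4 := Cmod_ge_0 (pder l z)).
  assert (Cmod z * Cmod (pder l z) * (s - t) <= t * pnorm s l).
  { rewrite Rmult_assoc. apply Rmult_le_compat; trivial.
    apply Rmult_le_pos; lra. }
  nra.
Qed.

(** The remainder [r] of the tail enters the next one as [y * r + pder l x * (y - x) ^ 2]. The two
    parts contribute with weights [t] and [s - t], whose sum is the factor [s] in [pnorm]. *)
Lemma peval_taylor t s l x y : Cmod x <= t -> Cmod y <= t -> t < s ->
  Cmod (peval l y - peval l x - pder l x * (y - x)) * (s - t) ^ 2
  <= Cmod (y - x) ^ 2 * pnorm s l.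
Proof.
  intros Hx Hy Hts. assert (Hy0 := Cmod_ge_0 y).
  assert (Hd := pow2_ge_0 (Cmod (y - x))).
  induction l as [|c l IH]; simpl peval; simpl pder; simpl pnorm.
  - replace (0 - 0 - 0 * (y - x))%C with (RtoC 0) by ring. rewrite Cmod_0. lra.
  - set (r := (peval l y - peval l x - pder l x * (y - x))%C) in *.
    replace (c + y * peval l y - (c + x * peval l x)
             - (peval l x + x * pder l x) * (y - x))%C
      with (y * r + pder l x * (y - x) ^ 2)%C by (unfold r; ring).
    assert (H1 := Cmod_triangle (y * r) (pder l x * (y - x) ^ 2)).
    rewrite !Cmod_mult, Cmod_pow in H1.
    assert (H2 := Cmod_pder t s l x Hx Hts).
    assert (H3 := Cmod_ge_0 c). assert (H4 := Cmod_ge_0 r).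
    assert (H5 := pnorm_ge_0 s l ltac:(lra)).
    set (d := Cmod (y - x) ^ 2) in *. set (N := pnorm s l) in *.
    assert (A1 : Cmod y * Cmod r * (s - t) ^ 2 <= t * (d * N)).
    { rewrite Rmult_assoc. apply Rmult_le_compat; trivial.
      apply Rmult_le_pos; [trivial|apply pow2_ge_0]. }
    assert (A2 : Cmod (pder l x) * d * (s - t) ^ 2 <= d * N * (s - t)).
    { replace (Cmod (pder l x) * d * (s - t) ^ 2)
        with ((d * (s - t)) * (Cmod (pder l x) * (s - t))) by ring.
      replace (d * N * (s - t)) with (d * (s - t) * N) by ring.
      apply Rmult_le_compat_l; trivial. apply Rmult_le_pos; lra. }
    apply Rle_trans with ((Cmod y * Cmod r + Cmod (pder l x) * d) * (s - t) ^ 2).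
    + apply Rmult_le_compat_r; [apply pow2_ge_0|exact H1].
    + assert (0 <= d * Cmod c) by (apply Rmult_le_pos; trivial). nra.
Qed.

Lemma root_sum_pow_or n m : (0 < n)%nat -> (0 < m <= n)%nat ->
  csum n (fun k => root n k ^ m)%C = if Nat.eq_dec m n then RtoC (INR n) else 0%C.
Proof.
  intros Hn Hm. destruct (Nat.eq_dec m n) as [->|H].
  - rewrite <- csum_1. apply csum_ext. intros; apply root_pow_n; trivial.
  - apply root_pow_sum. lia.
Qed.

(* Averaging [P] against the conjugate [j]-th powers of the [n]-th roots of unity
   ([i = n - j]) isolates the [j]-th coefficient as soon as [n] exceeds the degree. *)
Lemma coeff_average n s l i : (0 < i <= n)%nat -> (length l + i <= 2 * n)%nat ->
  csum n (fun k => root n k ^ i * peval l (RtoC s * root n k))%C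
  = (RtoC (INR n) * RtoC s ^ (n - i) * nth (n - i) l (RtoC 0))%C.
Proof.
  revert i. induction l as [|c l IH]; intros i Hi Hl; simpl peval; simpl length in Hl.
  - rewrite (csum_ext n _ (fun k => 0 * root n k)%C) by (intros; ring).
    rewrite csum_scal. destruct (n - i)%nat; simpl; ring.
  - rewrite (csum_ext n _ (fun k => c * root n k ^ i
       + RtoC s * (root n k ^ S i * peval l (RtoC s * root n k)))%C)
      by (intros; rewrite Cpow_S; ring).
    rewrite csum_plus, (csum_scal n c (fun k => root n k ^ i)%C),
      (csum_scal n (RtoC s)).
    rewrite root_sum_pow_or by lia.
    destruct (Nat.eq_dec i n) as [->|Hne].
    + rewrite Nat.sub_diag. simpl nth.
      (* Since [i = n], the exponent [n + 1] wraps around to 1; the average then picks the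
         coefficient [n - 1] of [l], which lies beyond its end and is 0. *)
      rewrite (csum_ext n _ (fun k => root n k ^ 1 * peval l (RtoC s * root n k))%C).
      2: { intros k Hk. rewrite Cpow_S, root_pow_n by lia. simpl. ring. }
      destruct (Nat.eq_dec n 1) as [->|Hn1].
      * destruct l; simpl in *; try lia. ring.
      * rewrite IH by lia. rewrite (nth_overflow l) by lia. simpl. ring.
    + rewrite IH by lia. replace (n - i)%nat with (S (n - S i)) by lia.
      rewrite Cpow_S. simpl nth. ring.
Qed.

Lemma coeff_bound s eps l j : 0 <= s ->
  (forall z, Cmod z = s -> Cmod (peval l z) <= eps) ->
  Cmod (nth j l (RtoC 0)) * s ^ j <= eps.
Proof.
  intros Hs H.
  (* Large enough that [n - j] is positive and that no other coefficient has an index congruent to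
     [j] modulo [n]. *)
  set (n := S (length l + j)).
  assert (Hn : 0 < INR n) by (apply lt_0_INR; unfold n; lia).
  assert (G := coeff_average n s l (n - j) ltac:(unfold n; lia) ltac:(unfold n; lia)).
  replace (n - (n - j))%nat with j in G by (unfold n; lia).
  apply (f_equal Cmod) in G.
  rewrite !Cmod_mult, Cmod_pow, !Cmod_R, !Rabs_pos_eq in G by lra.
  assert (B := Cmod_csum n (fun k => root n k ^ (n - j) * peval l (RtoC s * root n k))%C).
  rewrite G in B.
  assert (B2 := rsum_le n
    (fun k => Cmod (root n k ^ (n - j) * peval l (RtoC s * root n k))%C)
    (fun _ => eps)).
  rewrite rsum_const in B2.
  apply (Rmult_le_reg_l (INR n)); trivial.
  apply Rle_trans with (2 := B2
    ltac:(intros k Hk; rewrite Cmod_mult, Cmod_pow, Cmod_root, pow1, Rmult_1_l;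
          apply H; rewrite Cmod_scal_R, Cmod_root by trivial; ring)).
  lra.
Qed.

(** A geometric series of ratio [t / s]. In the induction the tail of the list satisfies the
    hypothesis with [eps / s]. *)
Lemma pnorm_coeff_bound t s eps l : 0 <= t < s -> 0 <= eps ->
  (forall j, Cmod (nth j l (RtoC 0)) * s ^ j <= eps) ->
  pnorm t l * (s - t) <= eps * s.
Proof.
  intros Hts. revert eps. induction l as [|c l IH]; intros eps He H; simpl.
  - nra.
  - assert (H0 := H 0%nat). simpl in H0. rewrite Rmult_1_r in H0.
    assert (G : pnorm t l * (s - t) <= eps / s * s).
    { apply IH.
      - apply Rle_mult_inv_pos; lra.
      - intros j. assert (Hj := H (S j)). simpl in Hj.
        apply (Rmult_le_reg_l s); [lra|]. unfold Rdiv.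
        replace (s * (eps * / s)) with eps by (field; lra). lra. }
    replace (eps / s * s) with eps in G by (field; lra). nra.
Qed.

Lemma cauchy_estimate t s eps l : 0 <= t < s -> 0 <= eps ->
  (forall z, Cmod z = s -> Cmod (peval l z) <= eps) ->
  pnorm t l * (s - t) <= eps * s.
Proof.
  intros Hts He H. apply pnorm_coeff_bound; trivial.
  intros j. apply coeff_bound; trivial. lra.
Qed.

(** * Uniform polynomial approximation and pole pushing *)

Definition papprox (E : C -> Prop) (g : C -> C) : Prop :=
  forall eps, 0 < eps -> exists l, forall z, E z -> Cmod (peval l z - g z) <= eps.

Definition bounded_on (E : C -> Prop) (g : C -> C) : Prop :=
  exists B, forall z, E z -> Cmod (g z) <= B.

Lemma papprox_ext E g h : (forall z, E z -> g z = h z) -> papprox E g -> papprox E h.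
Proof.
  intros H Hg eps He. destruct (Hg eps He) as [l Hl]. exists l.
  intros z Hz. rewrite <- H by trivial. auto.
Qed.

Lemma papprox_poly E l : papprox E (peval l).
Proof.
  intros eps He. exists l. intros z _.
  replace (peval l z - peval l z)%C with (RtoC 0) by ring. rewrite Cmod_0. lra.
Qed.

Lemma papprox_const E c : papprox E (fun _ => c).
Proof.
  apply papprox_ext with (2 := papprox_poly E (c :: nil)). intros; simpl; ring.
Qed.

Lemma papprox_plus E g h : papprox E g -> papprox E h -> papprox E (fun z => g z + h z)%C.
Proof.
  intros Hg Hh eps He.
  destruct (Hg (eps / 2)) as [p Hp]; [lra|]. destruct (Hh (eps / 2)) as [q Hq]; [lra|].
  exists (padd p q). intros z Hz. rewrite peval_padd.
  replace (peval p z + peval q z - (g z + h z))%C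
    with ((peval p z - g z) + (peval q z - h z))%C by ring.
  eapply Rle_trans; [apply Cmod_triangle|].
  specialize (Hp z Hz). specialize (Hq z Hz). lra.
Qed.

Lemma papprox_mult E g h : bounded_on E g -> bounded_on E h ->
  papprox E g -> papprox E h -> papprox E (fun z => g z * h z)%C.
Proof.
  intros [B HB] [D HD] Hg Hh eps He.
  assert (HB1 : 0 < 1 + Rabs B) by (assert (G := Rabs_pos B); lra).
  assert (HD1 : 0 < 1 + Rabs D) by (assert (G := Rabs_pos D); lra).
  set (M := (1 + Rabs B) + (1 + Rabs D)).
  set (e := Rmin 1 (eps / M)).
  assert (He0 : 0 < e) by (apply Rmin_pos; [lra|apply Rdiv_lt_0_compat; unfold M; lra]).
  assert (He1 : e <= 1) by apply Rmin_l.
  assert (He2 : e * M <= eps).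
  { apply Rle_trans with (eps / M * M).
    - apply Rmult_le_compat_r; [unfold M; lra|apply Rmin_r].
    - right. field. unfold M. lra. }
  destruct (Hg e He0) as [p Hp]. destruct (Hh e He0) as [q Hq].
  exists (pmul p q). intros z Hz. rewrite peval_pmul.
  replace (peval p z * peval q z - g z * h z)%C
    with ((peval p z - g z) * (peval q z - h z)
          + (g z * (peval q z - h z) + (peval p z - g z) * h z))%C by ring.
  eapply Rle_trans; [apply Cmod_triangle|].
  assert (T := Cmod_triangle (g z * (peval q z - h z)) ((peval p z - g z) * h z)).
  rewrite !Cmod_mult in *.
  specialize (Hp z Hz). specialize (Hq z Hz). specialize (HB z Hz). specialize (HD z Hz).
  assert (B1 := Rle_abs B). assert (D1 := Rle_abs D).
  assert (P0 := Cmod_ge_0 (peval p z - g z)). assert (Q0 := Cmod_ge_0 (peval q z - h z)).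
  assert (G0 := Cmod_ge_0 (g z)). assert (K0 := Cmod_ge_0 (h z)).
  assert (I1 : Cmod (peval p z - g z) * Cmod (peval q z - h z) <= 1 * e)
    by (apply Rmult_le_compat; lra).
  assert (I2 : Cmod (g z) * Cmod (peval q z - h z) <= Rabs B * e)
    by (apply Rmult_le_compat; lra).
  assert (I3 : Cmod (peval p z - g z) * Cmod (h z) <= e * Rabs D)
    by (apply Rmult_le_compat; lra).
  unfold M in He2. lra.
Qed.

Lemma papprox_scal E c g : papprox E g -> papprox E (fun z => c * g z)%C.
Proof.
  intros Hg eps He. assert (G := Cmod_ge_0 c).
  destruct (Hg (eps / (1 + Cmod c))) as [l Hl]; [apply Rdiv_lt_0_compat; lra|].
  exists (pscal c l). intros z Hz. rewrite peval_pscal.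
  replace (c * peval l z - c * g z)%C with (c * (peval l z - g z))%C by ring.
  rewrite Cmod_mult. specialize (Hl z Hz).
  apply Rle_trans with ((1 + Cmod c) * (eps / (1 + Cmod c))); [|right; field; lra].
  apply Rmult_le_compat; trivial; try lra. apply Cmod_ge_0.
Qed.

Lemma papprox_csum E n (g : nat -> C -> C) :
  (forall k, (k < n)%nat -> papprox E (g k)) -> papprox E (fun z => csum n (fun k => g k z)).
Proof.
  induction n as [|n IH]; intros H; simpl; [apply papprox_const|].
  apply papprox_plus; [apply IH; intros|]; apply H; lia.
Qed.

Lemma papprox_inv_one_minus E y th : th < 1 -> (forall z, E z -> Cmod (y z) <= th) ->
  papprox E y -> papprox E (fun z => / (1 - y z))%C.
Proof.
  intros Hth1 Hy Ha.
  (* Only a point of [E] shows that [th] is nonnegative. *)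
  destruct (Classical_Prop.classic (exists z0, E z0)) as [[z0 Hz0]|Hn].
  2: { intros eps _. exists nil. intros z Hz. destruct Hn. exists z; trivial. }
  assert (Hth0 : 0 <= th) by (apply Rle_trans with (2 := Hy z0 Hz0), Cmod_ge_0).
  assert (HG : forall n, bounded_on E (fun z => csum n (fun k => y z ^ k)%C)
                    /\ papprox E (fun z => csum n (fun k => y z ^ k)%C)).
  { induction n as [|n [[B HB] IH]].
    - split; [exists 0; intros; simpl; rewrite Cmod_0; lra|exact (papprox_const E 0%C)].
    (* Horner's form of the partial sum: each stage needs one more product, of functions already
       known to be bounded. *)
    - assert (Erec : forall z, csum (S n) (fun k => y z ^ k)%C
                          = (1 + y z * csum n (fun k => y z ^ k))%C).
      { intros z. rewrite <- csum_scal. clear. induction n as [|n IH]; simpl; [ring|].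
        simpl in IH. rewrite IH. ring. }
      split.
      + exists (1 + th * B). intros z Hz. rewrite Erec.
        eapply Rle_trans; [apply Cmod_triangle|]. rewrite Cmod_1, Cmod_mult.
        apply Rplus_le_compat_l, Rmult_le_compat; auto using Cmod_ge_0.
      + eapply papprox_ext; [intros z _; symmetry; apply Erec|].
        apply papprox_plus; [apply papprox_const|].
        apply papprox_mult; trivial; [exists th; auto|exists B; auto]. }
  intros eps He.
  destruct (pow_lt_1_zero th ltac:(rewrite Rabs_pos_eq; lra) (eps / 2 * (1 - th)))
    as [n Hn]; [apply Rmult_lt_0_compat; lra|].
  specialize (Hn n (le_n n)).
  destruct (HG n) as [_ Hp]. destruct (Hp (eps / 2)) as [l Hl]; [lra|].
  exists l. intros z Hz. specialize (Hl z Hz).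
  eapply Rle_trans; [apply (Cmod_triangle_mid (csum n (fun k => y z ^ k)%C))|].
  apply Rle_trans with (eps / 2 + eps / 2); [|lra].
  apply Rplus_le_compat; trivial.
  assert (H1 := Cmod_one_minus (y z)). assert (H2 := Hy z Hz).
  assert (H0 : (1 - y z)%C <> 0%C) by (apply one_minus_neq_0; lra).
  replace (csum n (fun k => y z ^ k) - / (1 - y z))%C with (- (y z ^ n * / (1 - y z)))%C.
  - rewrite Cmod_opp, Cmod_mult, Cmod_pow, Cmod_inv by trivial.
    apply (Rmult_le_reg_r (Cmod (1 - y z))); [lra|].
    rewrite Rmult_assoc, Rinv_l, Rmult_1_r by lra.
    apply Rle_trans with (th ^ n).
    + apply pow_incr. split; [apply Cmod_ge_0|trivial].
    + rewrite Rabs_pos_eq in Hn by (apply pow_le; trivial).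
      apply Rle_trans with (eps / 2 * (1 - th)); [lra|].
      apply Rmult_le_compat_l; lra.
  - replace (y z ^ n)%C with (1 - (1 - y z) * csum n (fun k => y z ^ k))%C
      by (rewrite csum_geom; ring).
    field. trivial.
Qed.

Definition pole_ok (E : C -> Prop) (b : C) : Prop := papprox E (fun z => / (b - z))%C.

Lemma pole_ok_far E b B : (forall z, E z -> Cmod z <= B) -> B < Cmod b -> pole_ok E b.
Proof.
  intros HE Hb.
  destruct (Classical_Prop.classic (exists z0, E z0)) as [[z0 Hz0]|Hn].
  2: { intros eps _. exists nil. intros z Hz. destruct Hn. exists z; trivial. }
  assert (HB : 0 <= B) by (apply Rle_trans with (2 := HE z0 Hz0), Cmod_ge_0).
  assert (Hb0 : b <> 0%C) by (apply Cmod_neq_0; lra).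
  assert (Hy : forall z, E z -> Cmod (/ b * z) <= B / Cmod b).
  { intros z Hz. rewrite Cmod_mult, Cmod_inv, Rmult_comm by trivial.
    apply Rmult_le_compat_r; auto. apply Rlt_le, Rinv_0_lt_compat; lra. }
  assert (H1 : B / Cmod b < 1).
  { apply (Rmult_lt_reg_r (Cmod b)); [lra|]. unfold Rdiv.
    rewrite Rmult_assoc, Rinv_l; lra. }
  apply papprox_ext with (fun z => / b * / (1 - / b * z))%C.
  - intros z Hz. assert (H2 : (1 - / b * z)%C <> 0%C).
    { apply one_minus_neq_0. specialize (Hy z Hz). lra. }
    assert (H3 : (b - z)%C <> 0%C).
    { intros E0. apply H2. replace z with b; [field; trivial|].
      replace b with ((b - z) + z)%C by ring. rewrite E0. ring. }
    field. repeat split; trivial.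
  - apply papprox_scal, papprox_inv_one_minus with (2 := Hy); trivial.
    apply papprox_ext with (2 := papprox_poly E (RtoC 0 :: (/ b)%C :: nil)).
    intros; simpl; ring.
Qed.

(* Geometric series in [(a - b) / (a - z)], of modulus at most [1 / 2] on [E]. *)
Lemma pole_ok_step E a b d : 0 < d -> (forall z, E z -> d <= Cmod (a - z)) ->
  Cmod (a - b) <= d / 2 -> pole_ok E a -> pole_ok E b.
Proof.
  intros Hd HE Hab Ha.
  assert (H0 : forall z, E z -> (a - z)%C <> 0%C).
  { intros z Hz. apply Cmod_neq_0. specialize (HE z Hz). lra. }
  assert (HB : forall z, E z -> Cmod (/ (a - z)) <= / d).
  { intros z Hz. rewrite Cmod_inv by auto. apply Rinv_le_contravar; auto. }
  assert (Hy : forall z, E z -> Cmod ((a - b) * / (a - z)) <= / 2).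
  { intros z Hz. rewrite Cmod_mult. apply Rle_trans with (d / 2 * / d).
    - apply Rmult_le_compat; auto using Cmod_ge_0.
    - right. field. lra. }
  assert (Hy0 : forall z, E z -> (1 - (a - b) * / (a - z))%C <> 0%C).
  { intros z Hz. apply one_minus_neq_0. specialize (Hy z Hz). lra. }
  apply papprox_ext with (fun z => / (a - z) * / (1 - (a - b) * / (a - z)))%C.
  - intros z Hz. assert (H2 := Hy0 z Hz). assert (H3 := H0 z Hz).
    assert (H4 : (b - z)%C <> 0%C).
    { intros E0. apply H2. replace (a - b)%C with (a - z - (b - z))%C by ring.
      rewrite E0. field. trivial. }
    field. repeat split; trivial.
  - apply papprox_mult; trivial.
    + exists (/ d). trivial.
    + exists 2. intros z Hz. rewrite Cmod_inv by auto.
      rewrite <- (Rinv_inv 2). apply Rinv_le_contravar; [lra|].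
      assert (G := Cmod_one_minus ((a - b) * / (a - z))). specialize (Hy z Hz). lra.
    + apply papprox_inv_one_minus with (2 := Hy); [lra|].
      apply papprox_scal. trivial.
Qed.

(** Runge's pole pushing. The path has speed at most 1 and keeps the distance [d] from [E], so
    [pole_ok_step] allows every parameter step of length [d / 2]; the induction is on the number of
    such steps. *)
Lemma pole_ok_path E (gam : R -> C) lo hi d : 0 < d ->
  (forall t t', Cmod (gam t - gam t') <= Rabs (t - t')) ->
  (forall t z, lo <= t <= hi -> E z -> d <= Cmod (gam t - z)) ->
  forall a b, lo <= a <= hi -> lo <= b <= hi -> pole_ok E (gam a) -> pole_ok E (gam b).
Proof.
  intros Hd HL HE a b Ha Hb Hok.
  assert (H : forall n b, lo <= b <= hi -> Rabs (a - b) <= INR n * (d / 2) ->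
    pole_ok E (gam b)).
  { induction n as [|n IH]; intros c Hc Hn.
    - simpl in Hn. rewrite Rmult_0_l in Hn.
      assert (a - c = 0) by (apply Rabs_eq_0; assert (G := Rabs_pos (a - c)); lra).
      replace c with a by lra. trivial.
    - rewrite S_INR in Hn.
      assert (Hm : exists m, lo <= m <= hi /\ Rabs (a - m) <= INR n * (d / 2)
                      /\ Rabs (m - c) <= d / 2).
      { assert (0 <= INR n * (d / 2)) by (apply Rmult_le_pos; [apply pos_INR|lra]).
        destruct (Rle_dec (Rabs (a - c)) (d / 2)) as [Hs|Hs].
        - exists a. rewrite Rminus_diag, Rabs_R0. lra.
        - destruct (Rle_dec a c).
          + exists (c - d / 2). rewrite Rabs_left1 in Hn, Hs by lra.
            rewrite Rabs_left1, Rabs_left1 by lra. lra.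
          + exists (c + d / 2). rewrite Rabs_pos_eq in Hn, Hs by lra.
            rewrite Rabs_pos_eq, Rabs_pos_eq by lra. lra. }
      destruct Hm as (m & Hm1 & Hm2 & Hm3).
      apply (pole_ok_step E (gam m) (gam c) d Hd); auto.
      eapply Rle_trans; [apply HL|trivial]. }
  destruct (nfloor_ex (Rabs (a - b) / (d / 2))) as [n Hn].
  - apply Rle_mult_inv_pos; [apply Rabs_pos|lra].
  - apply (H (S n)); trivial. rewrite S_INR.
    apply Rle_trans with (Rabs (a - b) / (d / 2) * (d / 2)); [right; field; lra|].
    apply Rmult_le_compat_r; lra.
Qed.

(** * A Poisson-type kernel with discrete poles *)

(* The poles [zeta / r] and [r ^ 3 * zeta] are mirror images in the circle [|z| = r],
   on which [kern r zeta] is therefore the Poisson kernel of parameter [r ^ 2];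
   the outer pole lies outside the closed unit disc. *)
Definition kern (r : R) (zeta z : C) : C :=
  (/ (1 - RtoC r * Cconj zeta * z)
   - RtoC (r ^ 3) * zeta * / (RtoC (r ^ 3) * zeta - z))%C.

(** The Poisson kernel, the real part of [(1 + q x) / (1 - q x)]. With a single fraction, its sum
    over roots of unity is given by [root_geom_sum]. *)
Definition poisson (q : R) (x : C) : R := 2 * Re (/ (1 - RtoC q * x))%C - 1.

Lemma Cmod_qx q x : 0 <= q < 1 -> Cmod x = 1 -> Cmod (RtoC q * x) < 1.
Proof. intros Hq Hx. rewrite Cmod_scal_R, Hx; lra. Qed.

Lemma RtoC_two_Re (w : C) : RtoC (2 * Re w) = (w + Cconj w)%C.
Proof. rewrite RtoC_mult, re_alt. field. Qed.

Lemma poisson_eq q x : 0 <= q < 1 -> Cmod x = 1 ->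
  poisson q x = (1 - q ^ 2) / Cmod (1 - RtoC q * x) ^ 2.
Proof.
  intros Hq Hx. apply RtoC_inj. unfold poisson.
  assert (Hn := one_minus_neq_0 _ (Cmod_qx q x Hq Hx)).
  assert (Hn2 : Cconj (1 - RtoC q * x) <> 0%C).
  { apply Cmod_neq_0. rewrite Cmod_conj. apply Cmod_gt_0. trivial. }
  assert (Hm : Cmod (1 - RtoC q * x) <> 0) by (apply Rgt_not_eq, Cmod_gt_0; trivial).
  unfold Rdiv. rewrite RtoC_minus, RtoC_two_Re, RtoC_mult, RtoC_inv, Cmod2_conj
    by (apply pow_nonzero; trivial).
  rewrite Cinv_conj by trivial.
  assert (E : (RtoC (1 - q ^ 2) = 1 - (RtoC q * x) * (RtoC q * Cconj x))%C).
  { rewrite RtoC_minus, RtoC_pow.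
    replace (RtoC q * x * (RtoC q * Cconj x))%C
      with (RtoC q * RtoC q * (x * Cconj x))%C by ring.
    rewrite Cmod_1_conj by trivial. ring. }
  rewrite E. revert Hn2.
  assert (Ec : Cconj (1 - RtoC q * x) = (1 - RtoC q * Cconj x)%C).
  { rewrite Cminus_conj, Cmult_conj. f_equal; [|f_equal]; apply injective_projections; simpl; ring. }
  rewrite Ec. intros Hn2. field. split; trivial.
Qed.

Lemma poisson_ge_0 q x : 0 <= q < 1 -> Cmod x = 1 -> 0 <= poisson q x.
Proof.
  intros Hq Hx. rewrite poisson_eq by trivial.
  apply Rle_mult_inv_pos; [nra|].
  apply pow_lt, Cmod_gt_0, one_minus_neq_0, Cmod_qx; trivial.
Qed.

Lemma poisson_far q zeta w del : 0 <= q < 1 -> Cmod zeta = 1 -> Cmod w = 1 -> 0 < del ->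
  del <= Cmod (zeta - w) -> poisson q (Cconj zeta * w) <= 4 * (1 - q ^ 2) / del ^ 2.
Proof.
  intros Hq Hz Hw Hd Hf.
  rewrite poisson_eq by (rewrite ?Cmod_mult, ?Cmod_conj; nra).
  assert (H : del / 2 <= Cmod (1 - RtoC q * (Cconj zeta * w))).
  { assert (G := unit_dist_scal w zeta 1 q Hw Hz ltac:(lra) ltac:(lra)).
    rewrite Rmult_1_l, (Cmod_minus_sym w) in G.
    replace (1 - RtoC q * (Cconj zeta * w))%C
      with (Cconj zeta * (RtoC 1 * zeta - RtoC q * w) + (1 - zeta * Cconj zeta))%C by ring.
    rewrite Cmod_1_conj by trivial.
    replace (Cconj zeta * (RtoC 1 * zeta - RtoC q * w) + (1 - 1))%C
      with (Cconj zeta * (RtoC 1 * zeta - RtoC q * w))%C by ring.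
    rewrite Cmod_mult, Cmod_conj, Hz, Cmod_minus_sym. lra. }
  replace (4 * (1 - q ^ 2) / del ^ 2) with ((1 - q ^ 2) * / (del / 2) ^ 2) by (field; lra).
  apply Rmult_le_compat_l; [nra|].
  apply Rinv_le_contravar; [apply pow_lt; lra|]. apply pow_incr. lra.
Qed.

(** With [y = q * y0], [root_geom_sum] gives [2 Re (1 / (1 - y ^ n)) - 1] for the average, which
    differs from 1 by [2 Re (y ^ n / (1 - y ^ n))]. The bound does not depend on [y0]. *)
Lemma poisson_average q n y0 : (0 < n)%nat -> 0 <= q < 1 -> Cmod y0 = 1 ->
  Rabs (/ INR n * rsum n (fun k => poisson q (y0 * root n k)) - 1)
  <= 2 * (q ^ n / (1 - q ^ n)).
Proof.
  intros Hn Hq Hy.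
  assert (HN : 0 < INR n) by (apply lt_0_INR; trivial).
  set (y := (RtoC q * y0)%C). assert (Hy1 := Cmod_qx q y0 Hq Hy). fold y in Hy1.
  assert (E : / INR n * rsum n (fun k => poisson q (y0 * root n k))
              = 2 * Re (/ (1 - y ^ n))%C - 1).
  { unfold poisson.
    rewrite (rsum_ext n _ (fun k => 2 * Re (/ (1 - y * root n k))%C + - 1)).
    2: { intros k _. unfold y. rewrite Cmult_assoc. ring. }
    rewrite rsum_plus, rsum_scal, rsum_const.
    rewrite <- (csum_Re n (fun k => / (1 - y * root n k))%C), root_geom_sum by trivial.
    unfold Cdiv. assert (R1 : forall w : C, Re (RtoC (INR n) * w) = INR n * Re w).
    { intros [a b]. unfold Re, Cmult. simpl fst. ring. }
    rewrite R1. field. lra. }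
  rewrite E.
  assert (Hm : Cmod (y ^ n) = q ^ n).
  { rewrite Cmod_pow. unfold y. rewrite Cmod_scal_R, Hy, Rmult_1_r; lra. }
  assert (Hq1 : q ^ n < 1) by (apply pow_lt_1_compat; [lra|trivial]).
  assert (H0 : (1 - y ^ n)%C <> 0%C) by (apply one_minus_neq_0; lra).
  replace (2 * Re (/ (1 - y ^ n))%C - 1 - 1) with (2 * Re (y ^ n * / (1 - y ^ n))%C).
  2: { replace (y ^ n * / (1 - y ^ n))%C with (/ (1 - y ^ n) - 1)%C by (field; trivial).
       simpl. ring. }
  rewrite Rabs_mult, (Rabs_pos_eq 2) by lra. apply Rmult_le_compat_l; [lra|].
  eapply Rle_trans; [apply re_le_Cmod|].
  rewrite Cmod_mult, Cmod_inv, Hm by trivial.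
  apply Rmult_le_compat_l; [rewrite <- Hm; apply Cmod_ge_0|].
  apply Rinv_le_contravar; [lra|]. rewrite <- Hm. apply Cmod_one_minus.
Qed.

(** With [v] for the first fraction of [kern], the identity [w * Cconj w = 1] turns the subtracted
    term into [1 - Cconj v], so that [v + Cconj v - 1] remains. *)
Lemma kern_on_circle r zeta w : 0 < r < 1 -> Cmod zeta = 1 -> Cmod w = 1 ->
  kern r zeta (RtoC r * w) = RtoC (poisson (r ^ 2) (Cconj zeta * w)).
Proof.
  intros Hr Hz Hw. unfold kern, poisson.
  assert (Hq : 0 <= r ^ 2 < 1) by nra.
  assert (Hx : Cmod (Cconj zeta * w) = 1) by (rewrite Cmod_mult, Cmod_conj; nra).
  assert (Hn := one_minus_neq_0 _ (Cmod_qx _ _ Hq Hx)).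
  assert (Hn2 : Cconj (1 - RtoC (r ^ 2) * (Cconj zeta * w)) <> 0%C).
  { apply Cmod_neq_0. rewrite Cmod_conj. apply Cmod_gt_0. trivial. }
  rewrite RtoC_minus, RtoC_two_Re, Cinv_conj by trivial.
  assert (Ec : Cconj (1 - RtoC (r ^ 2) * (Cconj zeta * w))
               = (1 - RtoC (r ^ 2) * (zeta * Cconj w))%C).
  { rewrite Cminus_conj, !Cmult_conj, Cconj_conj.
    f_equal; [|f_equal]; apply injective_projections; simpl; ring. }
  rewrite Ec in *.
  replace (RtoC r * Cconj zeta * (RtoC r * w))%C
    with (RtoC (r ^ 2) * (Cconj zeta * w))%C by (rewrite RtoC_pow; ring).
  set (v := (/ (1 - RtoC (r ^ 2) * (Cconj zeta * w)))%C).
  assert (Hr0 : RtoC r <> 0%C) by (intros H; apply RtoC_inj in H; lra).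
  assert (Hw0 : w <> 0%C) by (apply Cmod_neq_0; lra).
  assert (Es : (RtoC (r ^ 3) * zeta - RtoC r * w
                = - (RtoC r * w) * (1 - RtoC (r ^ 2) * (zeta * Cconj w)))%C).
  { rewrite !RtoC_pow.
    replace (- (RtoC r * w) * (1 - RtoC r ^ 2 * (zeta * Cconj w)))%C
      with (RtoC r ^ 3 * zeta * (w * Cconj w) - RtoC r * w)%C by ring.
    rewrite Cmod_1_conj by trivial. ring. }
  rewrite Es.
  assert (Et : (RtoC (r ^ 3) * zeta
                = RtoC r * w * (1 - (1 - RtoC (r ^ 2) * (zeta * Cconj w))))%C).
  { rewrite !RtoC_pow.
    replace (RtoC r * w * (1 - (1 - RtoC r ^ 2 * (zeta * Cconj w))))%C
      with (RtoC r ^ 3 * zeta * (w * Cconj w))%C by ring.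
    rewrite Cmod_1_conj by trivial. ring. }
  rewrite Et. set (t := (1 - RtoC (r ^ 2) * (zeta * Cconj w))%C) in *.
  field. repeat split; trivial.
Qed.

(** With [a] and [b] for the inner and outer pole, the fractions combine to [z * (a - b)] over
    [(a - z) * (b - z)]. The poles merge as [r] tends to 1, so the numerator tends to 0. *)
Lemma kern_small r zeta z d : 0 < r < 1 -> Cmod zeta = 1 -> Cmod z <= 1 -> 0 < d ->
  d <= Cmod (RtoC (r ^ 3) * zeta - z) -> d <= Cmod (RtoC (/ r) * zeta - z) ->
  Cmod (kern r zeta z) <= (/ r - r ^ 3) / d ^ 2.
Proof.
  intros Hr Hz Hz1 Hd H1 H2.
  set (a := (RtoC (r ^ 3) * zeta)%C) in *. set (b := (RtoC (/ r) * zeta)%C) in *.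
  assert (Ha : (a - z)%C <> 0%C) by (apply Cmod_neq_0; lra).
  assert (Hb : (b - z)%C <> 0%C) by (apply Cmod_neq_0; lra).
  assert (Hr0 : RtoC r <> 0%C) by (intros H; apply RtoC_inj in H; lra).
  assert (Hc0 : zeta <> 0%C) by (apply Cmod_neq_0; lra).
  assert (E : kern r zeta z = (z * (a - b) * (/ (a - z) * / (b - z)))%C).
  { unfold kern. fold a.
    replace (1 - RtoC r * Cconj zeta * z)%C with (RtoC r * Cconj zeta * (b - z))%C.
    2: { unfold b. rewrite RtoC_inv by lra.
         replace (RtoC r * Cconj zeta * (/ RtoC r * zeta - z))%C
           with (RtoC r * / RtoC r * (zeta * Cconj zeta) - RtoC r * Cconj zeta * z)%C by ring.
         rewrite Cmod_1_conj, Cinv_r by trivial. ring. }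
    assert (Hcc : Cconj zeta <> 0%C) by (apply Cmod_neq_0; rewrite Cmod_conj; lra).
    replace (/ (RtoC r * Cconj zeta * (b - z)))%C with (b * / (b - z))%C.
    - field. split; trivial.
    - unfold b at 1. rewrite RtoC_inv by lra.
      replace (/ RtoC r * zeta)%C with (/ (RtoC r * Cconj zeta))%C.
      + field. repeat split; trivial.
      + rewrite <- (Cmult_1_r (/ (RtoC r * Cconj zeta))), <- (Cmod_1_conj zeta) by trivial.
        field. split; trivial. }
  rewrite E, !Cmod_mult, !Cmod_inv by trivial.
  assert (Hab : Cmod (a - b) = / r - r ^ 3).
  { unfold a, b. replace (RtoC (r ^ 3) * zeta - RtoC (/ r) * zeta)%C
      with (- (RtoC (/ r - r ^ 3) * zeta))%C by (rewrite RtoC_minus; ring).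
    rewrite Cmod_opp, Cmod_scal_R, Hz; [ring|].
    assert (1 <= / r) by (rewrite <- Rinv_1; apply Rinv_le_contravar; lra). nra. }
  assert (Hp := Cmod_ge_0 (a - b)). assert (Hz0 := Cmod_ge_0 z).
  rewrite Hab in *. unfold Rdiv. apply Rmult_le_compat.
  - apply Rmult_le_pos; trivial.
  - apply Rlt_le, Rmult_lt_0_compat; apply Rinv_0_lt_compat; lra.
  - nra.
  - replace (/ d ^ 2) with (/ d * / d) by (field; lra).
    apply Rmult_le_compat; try (apply Rlt_le, Rinv_0_lt_compat; lra);
      apply Rinv_le_contravar; lra.
Qed.

Lemma papprox_kern E r zeta : 0 < r < 1 -> Cmod zeta = 1 ->
  (forall z, E z -> Cmod z <= 1) -> pole_ok E (RtoC (r ^ 3) * zeta)%C ->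
  papprox E (kern r zeta).
Proof.
  intros Hr Hz HE Hp. unfold kern.
  apply papprox_ext with (fun z => / (1 - (RtoC r * Cconj zeta) * z)
   + (- (RtoC (r ^ 3) * zeta)) * / (RtoC (r ^ 3) * zeta - z))%C.
  { intros; ring. }
  apply papprox_plus.
  - apply papprox_inv_one_minus with r; [lra| |].
    + intros z H. rewrite !Cmod_mult, Cmod_conj, Hz, Cmod_R, Rabs_pos_eq by lra.
      specialize (HE z H). assert (G := Cmod_ge_0 z). nra.
    + apply papprox_ext with (2 := papprox_poly E (RtoC 0 :: (RtoC r * Cconj zeta)%C :: nil)).
      intros; simpl; ring.
  - apply papprox_scal. exact Hp.
Qed.

(* A disc, a cap at [zeta0], and the arc of the circle [|z| = r] that misses the
   gap around [g]; its complement is connected through the gap. *)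
Definition gapped_set (zeta0 g : C) (kappa s eta r : R) (z : C) : Prop :=
  Cmod z <= 1 /\
  (Cmod z <= s \/ Cmod (z - zeta0) <= eta \/
   exists w, Cmod w = 1 /\ kappa <= Cmod (w - g) /\ z = (RtoC r * w)%C).

(* The pole travels along the circle of radius [r ^ 3] to the ray through [g],
   without meeting the cap, and then escapes along that ray. *)
Lemma pole_ok_gapped zeta0 g kappa s eta r zeta :
  Cmod zeta0 = 1 -> Cmod g = 1 -> Cmod zeta = 1 -> 0 < kappa -> 0 < eta ->
  0 < r < 1 -> s < r ^ 3 ->
  4 * eta <= Cmod (g - zeta0) -> 4 * eta <= Cmod (zeta - zeta0) ->
  pole_ok (gapped_set zeta0 g kappa s eta r) (RtoC (r ^ 3) * zeta)%C.
Proof.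
  intros Hz0 Hg Hz Hk He Hr Hs Hge Hze.
  assert (Hr3 : 0 < r ^ 3 < r).
  { split; [apply pow_lt; lra|]. replace (r ^ 3) with (r * (r * r)) by ring.
    rewrite <- (Rmult_1_r r) at 4. apply Rmult_lt_compat_l; nra. }
  assert (Hrad : pole_ok (gapped_set zeta0 g kappa s eta r) (RtoC (r ^ 3) * g)%C).
  (* The three terms serve the disc, the cap and the arc beside the gap. For the cap, directions
     [4 * eta] apart give points [2 * eta] apart, and the cap itself takes [eta]. *)
  { set (d := Rmin (r ^ 3 - s) (Rmin eta (r * kappa / 2))).
    assert (Hd : 0 < d) by (repeat apply Rmin_pos; nra).
    assert (Hd1 : d <= r ^ 3 - s) by apply Rmin_l.
    assert (Hd2 : d <= eta) by (eapply Rle_trans; [apply Rmin_r|apply Rmin_l]).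
    assert (Hd3 : d <= r * kappa / 2) by (eapply Rle_trans; [apply Rmin_r|apply Rmin_r]).
    apply (pole_ok_path _ (fun t => RtoC t * g)%C (r ^ 3) 2 d Hd) with (a := 2); try lra.
    - intros t t'. replace (RtoC t * g - RtoC t' * g)%C with (RtoC (t - t') * g)%C
        by (rewrite RtoC_minus; ring).
      rewrite Cmod_mult, Cmod_R, Hg. lra.
    - intros t z Ht [_ [H|[H|(w & Hw & Hwg & ->)]]].
      + assert (G := Cmod_triangle_rev (RtoC t * g) z).
        rewrite Cmod_scal_R, Hg in G by lra. lra.
      + assert (G := unit_dist_scal g zeta0 1 t Hg Hz0 ltac:(lra) ltac:(lra)).
        rewrite Cmult_1_l, Rmult_1_l in G.
        assert (G2 := Cmod_triangle_mid z (RtoC t * g) zeta0). lra.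
      + assert (G := unit_dist_scal g w r t Hg Hw ltac:(lra) ltac:(lra)).
        rewrite (Cmod_minus_sym g) in G. nra.
    - apply pole_ok_far with 1; [intros z [H _]; exact H|].
      rewrite Cmod_scal_R, Hg; lra. }
  (* Angles are measured from [zeta0], so the path between the angles of [g] and [zeta] in
     [[0, 2 * PI)] does not cross the direction of the cap. *)
  assert (Hrot : forall x, Cmod x = 1 -> exists t, 0 <= t < 2 * PI /\ x = (zeta0 * cis t)%C).
  { intros x Hx. destruct (arg_exists (Cconj zeta0 * x)) as (t & Ht & E).
    - rewrite Cmod_mult, Cmod_conj, Hz0, Hx. ring.
    - exists t. split; trivial. rewrite <- E, Cmult_assoc, Cmod_1_conj by trivial. ring. }
  assert (Hch : forall t, Cmod (zeta0 * cis t - zeta0) = Cmod (cis t - 1)).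
  { intros t. replace (zeta0 * cis t - zeta0)%C with (zeta0 * (cis t - 1))%C by ring.
    rewrite Cmod_mult, Hz0. ring. }
  destruct (Hrot g Hg) as (al & Hal & Eg). destruct (Hrot zeta Hz) as (be & Hbe & Ez).
  rewrite Eg, Hch in Hge. rewrite Ez, Hch in Hze. rewrite Eg in Hrad at 2. rewrite Ez.
  set (d := Rmin (r ^ 3 - s) (Rmin eta (r - r ^ 3))).
  assert (Hd : 0 < d) by (repeat apply Rmin_pos; lra).
  assert (Hd1 : d <= r ^ 3 - s) by apply Rmin_l.
  assert (Hd2 : d <= eta) by (eapply Rle_trans; [apply Rmin_r|apply Rmin_l]).
  assert (Hd3 : d <= r - r ^ 3) by (eapply Rle_trans; [apply Rmin_r|apply Rmin_r]).
  apply (pole_ok_path _ (fun t => RtoC (r ^ 3) * (zeta0 * cis t))%C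
           (Rmin al be) (Rmax al be) d Hd) with (a := al); trivial.
  - intros t t'.
    replace (RtoC (r ^ 3) * (zeta0 * cis t) - RtoC (r ^ 3) * (zeta0 * cis t'))%C
      with (RtoC (r ^ 3) * (zeta0 * (cis t - cis t')))%C by ring.
    rewrite Cmod_scal_R, Cmod_mult, Hz0 by lra.
    assert (G := cis_lipschitz t t'). assert (G2 := Cmod_ge_0 (cis t - cis t')). nra.
  - intros t z Ht.
    assert (Hu : Cmod (zeta0 * cis t) = 1) by (rewrite Cmod_mult, Hz0, Cmod_cis; ring).
    assert (Hc : 4 * eta <= Cmod (cis t - 1)).
    { unfold Rmin, Rmax in Ht. destruct (Rle_dec al be).
      - eapply Rle_trans; [|apply (chord_between al t be); lra]. apply Rmin_glb; trivial.
      - eapply Rle_trans; [|apply (chord_between be t al); lra]. apply Rmin_glb; trivial. }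
    assert (G := Cmod_triangle_rev (RtoC (r ^ 3) * (zeta0 * cis t)) z).
    rewrite Cmod_scal_R, Hu in G by lra.
    intros [_ [H|[H|(w & Hw & Hwg & ->)]]].
    + lra.
    + assert (G1 := unit_dist_scal (zeta0 * cis t) zeta0 1 (r ^ 3) Hu Hz0
        ltac:(lra) ltac:(lra)).
      rewrite Cmult_1_l, Rmult_1_l, Hch in G1.
      assert (G2 := Cmod_triangle_mid z (RtoC (r ^ 3) * (zeta0 * cis t)) zeta0). lra.
    + assert (G1 := Cmod_triangle_rev (RtoC r * w) (RtoC (r ^ 3) * (zeta0 * cis t))).
      rewrite Cmod_minus_sym in G1. rewrite !Cmod_scal_R, Hu, Hw in G1 by lra. lra.
  - split; [apply Rmin_l|apply Rmax_l].
  - split; [apply Rmin_r|apply Rmax_r].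
Qed.

(** * Discrete Poisson integrals and their polynomial approximation *)

Lemma poisson_average_le (n : nat) q y0 (v : nat -> R) b F :
  (0 < n)%nat -> 0 <= q < 1 -> Cmod y0 = 1 -> 0 <= b ->
  (forall k, (k < n)%nat -> v k * poisson q (y0 * root n k)
                            <= b * poisson q (y0 * root n k) + F) ->
  / INR n * rsum n (fun k => v k * poisson q (y0 * root n k))
  <= b + b * (2 * (q ^ n / (1 - q ^ n))) + F.
Proof.
  intros Hn Hq Hy Hb H.
  assert (HN : 0 < INR n) by (apply lt_0_INR; trivial).
  assert (A := poisson_average q n y0 Hn Hq Hy).
  set (D := / INR n * rsum n (fun k => poisson q (y0 * root n k))) in *.
  set (e := 2 * (q ^ n / (1 - q ^ n))) in *.
  apply Rabs_le_between in A.
  apply Rle_trans with (/ INR n * rsum n (fun k => b * poisson q (y0 * root n k) + F)).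
  - apply Rmult_le_compat_l; [apply Rlt_le, Rinv_0_lt_compat; trivial|].
    apply rsum_le. exact H.
  - rewrite rsum_plus, rsum_scal, rsum_const.
    replace (/ INR n * (b * rsum n (fun k => poisson q (y0 * root n k)) + INR n * F))
      with (b * D + F) by (unfold D; field; lra).
    nra.
Qed.

(** The last two conditions bound the kernel away from its poles and away from its peak. As [d] is
    fixed before [r], both left sides are at most constant multiples of [1 - r]. *)
Lemma radius_choice s eta del eps V : s < 1 -> 0 < eta -> 0 < del -> 0 < eps -> 0 <= V ->
  exists r0 d, r0 < 1 /\ 0 < d <= eta /\ forall r, r0 < r < 1 ->
    0 < r /\ s + d <= r ^ 3 /\ V * ((/ r - r ^ 3) / d ^ 2) <= eps / 2 /\
    2 * V * (4 * (1 - (r ^ 2) ^ 2) / del ^ 2) <= eps / 4.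
Proof.
  intros Hs He Hd Hp HV.
  set (d := Rmin ((1 - s) / 2) eta).
  assert (Hd0 : 0 < d) by (apply Rmin_pos; lra).
  assert (Hd1 : d <= (1 - s) / 2) by apply Rmin_l.
  (* An upper bound for [x = 1 - r]. The constants come from [r ^ 3 >= 1 - 3 x],
     [/ r - r ^ 3 <= 8 x] and [1 - r ^ 4 <= 4 x]. *)
  set (x0 := Rmin (/ 2) (Rmin ((1 - s) / 6)
     (Rmin (eps * d ^ 2 / (16 * (V + 1))) (eps * del ^ 2 / (128 * (V + 1)))))).
  assert (Hd2 : 0 < d ^ 2) by (apply pow_lt; trivial).
  assert (Hdel2 : 0 < del ^ 2) by (apply pow_lt; trivial).
  assert (Hx0 : 0 < x0).
  { repeat apply Rmin_pos; try lra; apply Rdiv_lt_0_compat; try lra;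
      apply Rmult_lt_0_compat; trivial. }
  assert (H1 : x0 <= / 2) by apply Rmin_l.
  assert (H2 : x0 <= (1 - s) / 6) by (eapply Rle_trans; [apply Rmin_r|apply Rmin_l]).
  assert (H3 : x0 <= eps * d ^ 2 / (16 * (V + 1)))
    by (eapply Rle_trans; [apply Rmin_r|eapply Rle_trans; [apply Rmin_r|apply Rmin_l]]).
  assert (H4 : x0 <= eps * del ^ 2 / (128 * (V + 1)))
    by (eapply Rle_trans; [apply Rmin_r|eapply Rle_trans; [apply Rmin_r|apply Rmin_r]]).
  clearbody x0.
  exists (1 - x0), d. split; [lra|]. split; [split; [trivial|apply Rmin_r]|].
  intros r Hr. set (x := 1 - r). assert (Hx : 0 < x < x0) by (unfold x; lra).
  assert (Er : r = 1 - x) by (unfold x; ring). clearbody x. subst r.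
  assert (P3 : 1 - 3 * x <= (1 - x) ^ 3).
  { replace ((1 - x) ^ 3) with (1 - 3 * x + x * x * (3 - x)) by ring.
    assert (0 <= x * x * (3 - x)) by (apply Rmult_le_pos; nra). lra. }
  assert (P4 : 1 - ((1 - x) ^ 2) ^ 2 <= 4 * x).
  { assert (1 - 2 * x <= (1 - x) ^ 2 <= 1) by nra.
    nra. }
  split; [lra|]. split; [lra|].
  assert (K1 : x * (16 * (V + 1)) <= eps * d ^ 2).
  { apply Rle_trans with (eps * d ^ 2 / (16 * (V + 1)) * (16 * (V + 1))).
    - apply Rmult_le_compat_r; lra.
    - right; field; lra. }
  assert (K2 : x * (128 * (V + 1)) <= eps * del ^ 2).
  { apply Rle_trans with (eps * del ^ 2 / (128 * (V + 1)) * (128 * (V + 1))).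
    - apply Rmult_le_compat_r; lra.
    - right; field; lra. }
  split.
  - assert (I : / (1 - x) <= 1 + 2 * x).
    { apply (Rmult_le_reg_r (1 - x)); [lra|]. rewrite Rinv_l by lra. nra. }
    apply (Rmult_le_reg_r (d ^ 2)); trivial.
    replace (V * ((/ (1 - x) - (1 - x) ^ 3) / d ^ 2) * d ^ 2)
      with (V * (/ (1 - x) - (1 - x) ^ 3)) by (field; split; lra).
    assert (V * (/ (1 - x) - (1 - x) ^ 3) <= V * (8 * x)) by (apply Rmult_le_compat_l; lra).
    nra.
  - apply (Rmult_le_reg_r (del ^ 2)); trivial.
    replace (2 * V * (4 * (1 - ((1 - x) ^ 2) ^ 2) / del ^ 2) * del ^ 2)
      with (8 * V * (1 - ((1 - x) ^ 2) ^ 2)) by (field; lra).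
    assert (8 * V * (1 - ((1 - x) ^ 2) ^ 2) <= 8 * V * (4 * x))
      by (apply Rmult_le_compat_l; lra).
    nra.
Qed.

Lemma geometric_small q e : 0 <= q < 1 -> 0 < e ->
  exists n, (0 < n)%nat /\ 2 * (q ^ n / (1 - q ^ n)) <= e.
Proof.
  intros Hq He.
  set (e' := Rmin (/ 2) (e / 4)).
  assert (He' : 0 < e') by (apply Rmin_pos; lra).
  destruct (pow_lt_1_zero q ltac:(rewrite Rabs_pos_eq; lra) e' He') as [n Hn].
  exists (S n). split; [lia|].
  specialize (Hn (S n) ltac:(lia)). rewrite Rabs_pos_eq in Hn by (apply pow_le; lra).
  assert (H1 : e' <= / 2) by apply Rmin_l. assert (H2 : e' <= e / 4) by apply Rmin_r.
  assert (H0 : 0 <= q ^ S n) by (apply pow_le; lra).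
  set (y := q ^ S n) in *.
  apply (Rmult_le_reg_r (1 - y)); [lra|].
  replace (2 * (y / (1 - y)) * (1 - y)) with (2 * y) by (field; lra). nra.
Qed.

(** The approximant is a discrete Poisson integral of [u] for the circle [|z| = r]. It is small on
    the disc and on the cap, which stay away from the poles in use, and on the circle the kernels
    form an approximate identity. As [u] vanishes near [zeta0], no pole is used that would have to
    be pushed through the cap. *)
Lemma kernel_approximation zeta0 g kappa s eta del eps V :
  Cmod zeta0 = 1 -> Cmod g = 1 -> 0 < kappa -> s < 1 -> 0 < eta ->
  4 * eta <= Cmod (g - zeta0) -> 0 < del -> 0 < eps -> 0 <= V ->
  exists r0, r0 < 1 /\ forall r, r0 < r < 1 -> forall u : C -> C,
    (forall zeta, Cmod zeta = 1 -> Cmod (u zeta) <= V) ->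
    (forall zeta, Cmod zeta = 1 -> Cmod (zeta - zeta0) < 4 * eta -> u zeta = 0%C) ->
    exists l,
      (forall z, Cmod z <= 1 -> Cmod z <= s \/ Cmod (z - zeta0) <= eta ->
         Cmod (peval l z) <= eps) /\
      (forall w c b, Cmod w = 1 -> kappa <= Cmod (w - g) -> Cmod c <= V ->
         (forall zeta, Cmod zeta = 1 -> Cmod (zeta - w) <= del -> Cmod (u zeta - c) <= b) ->
         Cmod (peval l (RtoC r * w) - c) <= b + eps).
Proof.
  intros Hz0 Hg Hk Hs He Hge Hd Hp HV.
  destruct (radius_choice s eta del eps V) as (r0 & d & Hr01 & Hd0 & Hr0); trivial.
  exists r0. split; trivial. intros r Hr u HuV Hu0.
  destruct (Hr0 r Hr) as (Hrp & Hsd & Hsmall & Hfar).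
  assert (Hq : 0 <= r ^ 2 < 1) by nra.
  (* This leaves [3 V e <= eps / 4]: the defect [e] of the total mass is charged [2 V] for the
     differences [u - c] and [V] for the constant [c]. *)
  destruct (geometric_small (r ^ 2) (eps / (12 * (V + 1)))) as (n & Hn & Hgeo); trivial.
  { apply Rdiv_lt_0_compat; lra. }
  set (e := 2 * ((r ^ 2) ^ n / (1 - (r ^ 2) ^ n))) in *.
  assert (He3 : 3 * V * e <= eps / 4).
  { apply Rle_trans with (3 * V * (eps / (12 * (V + 1)))).
    - apply Rmult_le_compat_l; lra.
    - replace (3 * V * (eps / (12 * (V + 1)))) with (V / (V + 1) * (eps / 4)) by (field; lra).
      rewrite <- (Rmult_1_l (eps / 4)) at 2. apply Rmult_le_compat_r; [lra|].
      apply (Rmult_le_reg_r (V + 1)); [lra|]. unfold Rdiv.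
      rewrite Rmult_assoc, Rinv_l; lra. }
  assert (HN : 0 < INR n) by (apply lt_0_INR; trivial).
  assert (HNi : 0 < / INR n) by (apply Rinv_0_lt_compat; trivial).
  (* The conjugate makes [Cconj (nu k) * w] equal to [y0 * root n k], the form in
     [poisson_average]. *)
  set (nu := fun k => (zeta0 * Cconj (root n k))%C).
  assert (Hnu : forall k, Cmod (nu k) = 1).
  { intros k. unfold nu. rewrite Cmod_mult, Cmod_conj, Cmod_root, Hz0. ring. }
  set (h := fun z => csum n (fun k => RtoC (/ INR n) * u (nu k) * kern r (nu k) z)%C).
  assert (Hh : papprox (gapped_set zeta0 g kappa s eta r) h).
  { apply (papprox_csum _ n (fun k z => RtoC (/ INR n) * u (nu k) * kern r (nu k) z)%C).
    intros k _. destruct (Rlt_dec (Cmod (nu k - zeta0)) (4 * eta)) as [Hc|Hc].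
    - apply papprox_ext with (2 := papprox_const _ 0%C).
      intros z _. rewrite Hu0 by auto. ring.
    - apply papprox_scal, papprox_kern; auto.
      + lra.
      + intros z [H _]; exact H.
      + apply pole_ok_gapped; auto; lra. }
  destruct (Hh (eps / 2) ltac:(lra)) as [l Hl].
  exists l. split.
  - intros z Hz1 Hz.
    assert (Hhz : Cmod (h z) <= eps / 2).
    { eapply Rle_trans; [apply Cmod_csum|].
      apply Rle_trans with (rsum n (fun _ => / INR n * (eps / 2))).
      2: { rewrite rsum_const. right. field. lra. }
      apply rsum_le. intros k _. rewrite !Cmod_mult, Cmod_R, Rabs_pos_eq, Rmult_assoc by lra.
      apply Rmult_le_compat_l; [lra|].
      destruct (Rlt_dec (Cmod (nu k - zeta0)) (4 * eta)) as [Hc|Hc].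
      - rewrite Hu0, Cmod_0 by auto. lra.
      - apply Rle_trans with (2 := Hsmall).
        apply Rmult_le_compat; auto using Cmod_ge_0.
        assert (Hri : 1 <= / r) by (rewrite <- Rinv_1; apply Rinv_le_contravar; lra).
        assert (Hr3 : r ^ 3 <= 1) by (rewrite <- (pow1 3); apply pow_incr; lra).
        assert (Hr3p : 0 <= r ^ 3) by (apply pow_le; lra).
        assert (Hdist : forall t, 0 <= t -> s + d <= t -> d <= Cmod (RtoC t * nu k - z)).
        { intros t Ht0 Ht. destruct Hz as [Hz|Hz].
          - assert (G := Cmod_triangle_rev (RtoC t * nu k) z).
            rewrite Cmod_scal_R, Hnu in G by trivial. lra.
          - assert (G := unit_dist_scal (nu k) zeta0 1 t (Hnu k) Hz0 ltac:(lra) Ht0).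
            rewrite Cmult_1_l, Rmult_1_l in G.
            assert (G2 := Cmod_triangle_mid z (RtoC t * nu k) zeta0). lra. }
        apply kern_small; auto; try lra; apply Hdist; lra. }
    assert (G := Hl z). assert (G2 := Cmod_triangle_mid (h z) (peval l z) 0).
    replace (peval l z - 0)%C with (peval l z) in G2 by ring.
    replace (h z - 0)%C with (h z) in G2 by ring.
    assert (Cmod (peval l z - h z) <= eps / 2).
    { apply G. split; trivial. tauto. }
    lra.
  - intros w c b Hw Hwg Hc Hb.
    set (y0 := (Cconj zeta0 * w)%C).
    assert (Hy0 : Cmod y0 = 1) by (unfold y0; rewrite Cmod_mult, Cmod_conj; nra).
    set (P := fun k => poisson (r ^ 2) (y0 * root n k)).
    assert (HP : forall k, 0 <= P k).
    { intros k. apply poisson_ge_0; trivial. rewrite Cmod_mult, Hy0, Cmod_root. ring. }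
    assert (Ek : forall k, kern r (nu k) (RtoC r * w) = RtoC (P k)).
    { intros k. rewrite kern_on_circle by (auto; lra). unfold P. do 2 f_equal.
      unfold nu, y0. rewrite Cmult_conj, Cconj_conj. ring. }
    assert (A := poisson_average (r ^ 2) n y0 Hn Hq Hy0). fold e P in A.
    set (D := / INR n * rsum n P) in A.
    (* The weights have total mass [D], which is only nearly 1; hence the second term. *)
    assert (Eh : (h (RtoC r * w) - c
                  = RtoC (/ INR n) * csum n (fun k => (u (nu k) - c) * RtoC (P k))
                    + c * (RtoC (D - 1)))%C).
    { rewrite (csum_ext n _ (fun k => u (nu k) * RtoC (P k) + (- c) * RtoC (P k))%C)
        by (intros; ring).
      rewrite csum_plus, (csum_scal n (- c)%C (fun k => RtoC (P k))), csum_RtoC.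
      unfold D. rewrite RtoC_minus, RtoC_mult. unfold h.
      rewrite (csum_ext n _ (fun k => RtoC (/ INR n) * (u (nu k) * RtoC (P k)))%C)
        by (intros; rewrite Ek; ring).
      rewrite csum_scal. ring. }
    (* [b] may be arbitrarily large, while [e] times the bound has to be small; the trivial bound
       [2 * V] caps it. *)
    set (b' := Rmin b (2 * V)).
    assert (Hb0 : 0 <= b).
    { apply Rle_trans with (Cmod (u w - c)); [apply Cmod_ge_0|]. apply Hb; trivial.
      replace (w - w)%C with (RtoC 0) by ring. rewrite Cmod_0. lra. }
    assert (Hb' : 0 <= b') by (apply Rmin_glb; lra).
    assert (Hb1 : b' <= b) by apply Rmin_l. assert (Hb2 : b' <= 2 * V) by apply Rmin_r.
    assert (He0 : 0 <= e) by (apply Rle_trans with (2 := A), Rabs_pos).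
    assert (Hsum : / INR n * rsum n (fun k => Cmod (u (nu k) - c) * P k)
                   <= b' + b' * e + eps / 4).
    { apply poisson_average_le; trivial. intros k _. fold (P k).
      assert (H2V : Cmod (u (nu k) - c) <= 2 * V).
      { eapply Rle_trans; [apply Cmod_minus_triangle|]. specialize (HuV _ (Hnu k)). lra. }
      destruct (Rle_dec (Cmod (nu k - w)) del) as [Hn1|Hn1].
      - assert (Cmod (u (nu k) - c) <= b') by (apply Rmin_glb; auto).
        assert (Cmod (u (nu k) - c) * P k <= b' * P k) by (apply Rmult_le_compat_r; auto).
        lra.
      - assert (F := poisson_far (r ^ 2) (nu k) w del Hq (Hnu k) Hw Hd ltac:(lra)).
        replace (Cconj (nu k) * w)%C with (y0 * root n k)%C in F
          by (unfold nu, y0; rewrite Cmult_conj, Cconj_conj; ring).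
        fold (P k) in F.
        assert (Cmod (u (nu k) - c) * P k
                <= 2 * V * (4 * (1 - (r ^ 2) ^ 2) / del ^ 2))
          by (apply Rmult_le_compat; auto using Cmod_ge_0).
        assert (0 <= b' * P k) by (apply Rmult_le_pos; auto). lra. }
    assert (Hhc : Cmod (h (RtoC r * w)%C - c) <= b + eps / 2).
    { rewrite Eh. eapply Rle_trans; [apply Cmod_triangle|].
      rewrite !Cmod_mult, !Cmod_R, (Rabs_pos_eq (/ INR n)) by lra.
      assert (T : / INR n * Cmod (csum n (fun k => (u (nu k) - c) * RtoC (P k))%C)
                  <= / INR n * rsum n (fun k => Cmod (u (nu k) - c) * P k)).
      { apply Rmult_le_compat_l; [lra|]. eapply Rle_trans; [apply Cmod_csum|].
        apply rsum_le. intros k _. rewrite Cmod_mult, Cmod_R, Rabs_pos_eq by auto. lra. }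
      assert (T2 : Cmod c * Rabs (D - 1) <= V * e)
        by (apply Rmult_le_compat; auto using Cmod_ge_0, Rabs_pos).
      assert (b' * e <= 2 * V * e) by (apply Rmult_le_compat_r; trivial).
      lra. }
    assert (G := Cmod_triangle_mid (h (RtoC r * w)%C) (peval l (RtoC r * w)) c).
    assert (Cmod (peval l (RtoC r * w)%C - h (RtoC r * w)%C) <= eps / 2).
    { apply Hl. split.
      - rewrite Cmod_scal_R, Hw by lra. lra.
      - right; right. exists w. auto. }
    lra.
Qed.

(** * One step of the construction *)

(** Otherwise points of [A] tend to the circle while staying [eta] away from [zeta0]. Their angles
    lie in [[0, 2 * PI]] and have a cluster point, which gives a point of the closure on the circle;
    by uniqueness it is [zeta0], a contradiction. *)
Lemma accumulation_point (A : C -> Prop) :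
  (forall z, A z -> unit_disc z) ->
  forall zeta0, (forall z, closureC A z -> unit_circle z -> z = zeta0) ->
  forall eta, 0 < eta -> exists s, s < 1 /\
    forall z, A z -> s < Cmod z -> Cmod (z - zeta0) <= eta.
Proof.
  intros HA zeta0 Huniq eta He.
  apply Classical_Prop.NNPP. intros Hno.
  assert (Hseq : forall n : nat, exists at_ : C * R,
    A (fst at_) /\ 1 - / (INR n + 1) < Cmod (fst at_) /\ eta < Cmod (fst at_ - zeta0) /\
    0 <= snd at_ <= 2 * PI /\ fst at_ = (RtoC (Cmod (fst at_)) * cis (snd at_))%C).
  { intros n. apply Classical_Prop.NNPP. intros Hn. apply Hno.
    assert (Hi : 0 < / (INR n + 1)) by (apply Rinv_0_lt_compat; assert (G := pos_INR n); lra).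
    exists (1 - / (INR n + 1)). split; [lra|]. intros z Hz Hz1.
    apply Rnot_lt_le. intros Hz2. apply Hn.
    assert (Hi1 : / (INR n + 1) <= 1).
    { rewrite <- Rinv_1. apply Rinv_le_contravar; assert (G := pos_INR n); lra. }
    assert (Hm : RtoC (Cmod z) <> 0%C) by (intros E; apply RtoC_inj in E; lra).
    destruct (arg_exists (/ RtoC (Cmod z) * z)) as (t & Ht & E).
    - rewrite Cmod_mult, Cmod_inv, Cmod_R, Rabs_pos_eq by (trivial; lra). field. lra.
    - exists (z, t). simpl. split; [trivial|]. do 2 (split; [trivial|]).
      split; [lra|]. rewrite <- E, Cmult_assoc, Cinv_r by trivial. ring. }
  apply functional_choice in Hseq. destruct Hseq as [a Ha].
  destruct (Bolzano_Weierstrass (fun n => snd (a n)) (fun c => 0 <= c <= 2 * PI)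
    (compact_P3 0 (2 * PI)) (fun n => proj1 (proj2 (proj2 (proj2 (Ha n)))))) as [t Ht].
  assert (Hclose : forall eps, 0 < eps -> exists n, Cmod (fst (a n) - cis t) < eps).
  { intros eps Hp.
    destruct (nfloor_ex (2 / eps)) as [N HN]; [apply Rle_mult_inv_pos; lra|].
    assert (Hn1 : neighbourhood (fun x => Rabs (x - t) < eps / 2) t).
    { exists (mkposreal (eps / 2) ltac:(lra)). intros x Hx. exact Hx. }
    destruct (Ht _ N Hn1) as (p & Hp1 & Hp2). exists p.
    destruct (Ha p) as (HA1 & HA2 & _ & _ & HA5).
    assert (HA3 := HA _ HA1). unfold unit_disc in HA3.
    rewrite HA5.
    replace (RtoC (Cmod (fst (a p))) * cis (snd (a p)) - cis t)%C
      with ((cis (snd (a p)) - cis t)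
            - RtoC (1 - Cmod (fst (a p))) * cis (snd (a p)))%C by (rewrite RtoC_minus; ring).
    eapply Rle_lt_trans; [apply Cmod_minus_triangle|].
    rewrite Cmod_scal_R, Cmod_cis by lra.
    assert (G := cis_lipschitz (snd (a p)) t).
    assert (Hpos := pos_INR p). assert (HpN := le_INR _ _ Hp1).
    assert (/ (INR p + 1) < eps / 2).
    { rewrite <- (Rinv_inv (eps / 2)).
      assert (/ (eps / 2) = 2 / eps) by (field; lra).
      assert (0 < 2 / eps) by (apply Rdiv_lt_0_compat; lra).
      apply Rinv_lt_contravar; [apply Rmult_lt_0_compat; lra|lra]. }
    lra. }
  assert (Hcis : cis t = zeta0).
  { apply Huniq; [|apply Cmod_cis]. intros eps Hp.
    destruct (Hclose eps Hp) as [n Hn]. exists (fst (a n)). split; [apply Ha|trivial]. }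
  destruct (Hclose eta He) as [n Hn]. rewrite Hcis in Hn.
  destruct (Ha n) as (_ & _ & H & _). lra.
Qed.

Lemma Cmod_one_minus_pow y n : Cmod y <= 1 -> Cmod (1 - y ^ n) <= INR n * Cmod (1 - y).
Proof.
  intros Hy. rewrite <- csum_geom, Cmod_mult, Rmult_comm.
  apply Rmult_le_compat_r; [apply Cmod_ge_0|].
  eapply Rle_trans; [apply Cmod_csum|].
  rewrite <- (Rmult_1_r (INR n)), <- rsum_const. apply rsum_le.
  intros k _. rewrite Cmod_pow, <- (pow1 k). apply pow_incr. split; [apply Cmod_ge_0|trivial].
Qed.

Lemma peval_monomial a n : exists l, forall z, peval l z = ((a * z) ^ n)%C.
Proof.
  induction n as [|n [l Hl]].
  - exists (RtoC 1 :: nil). intros; simpl; ring.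
  - exists (pscal a (RtoC 0 :: l)). intros z. rewrite peval_pscal. simpl.
    rewrite Hl. ring.
Qed.

(* [W = Y ^ N + (1 - Y ^ N) X] with [Y = z / zeta0]: near [zeta0] the power takes care of
   the rise from 0 to 1 with modulus at most 1, elsewhere the kernel [X] does. *)
Lemma correction_step (rho : nat -> R) (A : C -> Prop) zeta0 :
  (forall n, 0 <= rho n < 1) -> is_lim_seq rho 1 ->
  (forall z, A z -> unit_disc z) -> Cmod zeta0 = 1 ->
  (forall eta, 0 < eta -> exists s, s < 1 /\
     forall z, A z -> s < Cmod z -> Cmod (z - zeta0) <= eta) ->
  forall (S : list C) (v : C -> C) B V g kappa del eps s N0,
  (forall z, Cmod z <= 1 -> Cmod (peval S z) <= B) ->
  (forall zeta, Cmod zeta = 1 -> Cmod (v zeta) <= V) ->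
  Cmod g = 1 -> g <> zeta0 -> 0 < kappa -> 0 < del -> 0 < eps -> 0 <= s < 1 ->
  exists (m : nat) (P : list C), (N0 <= m)%nat /\ pnorm s P <= eps /\
    (forall z, A z -> Cmod (peval P z) <= 2 * (V + B) + 1) /\
    (forall w c b, Cmod w = 1 -> kappa <= Cmod (w - g) -> Cmod c <= V ->
       (forall zeta, Cmod zeta = 1 -> Cmod (zeta - w) <= del -> Cmod (v zeta - c) <= b) ->
       Cmod (peval (padd S P) (RtoC (rho m) * w) - c) <= b + eps).
Proof.
  intros Hrho Hlim HA Hz0 Hcap S v B V g kappa del eps s N0 HB HV Hg Hgz Hk Hd Hp Hs.
  set (c0 := v zeta0).
  assert (Hc0 : Cmod c0 <= V) by (apply HV; trivial).
  assert (HV0 : 0 <= V) by (apply Rle_trans with (2 := Hc0), Cmod_ge_0).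
  assert (HB0 : 0 <= B).
  { apply Rle_trans with (2 := HB 0%C ltac:(rewrite Cmod_0; lra)), Cmod_ge_0. }
  set (M := V + B). assert (HM : 0 <= M) by (unfold M; lra).
  (* [P] is estimated on the larger circle [|z| = t], since Cauchy's estimate for [pnorm s] loses a
     factor [t / (t - s)]; [e2] absorbs it. *)
  set (t := (1 + s) / 2). assert (Ht : s < t < 1) by (unfold t; lra).
  set (e2 := eps * (t - s)).
  assert (He2 : 0 < e2 <= eps) by (unfold e2; split; [apply Rmult_lt_0_compat; lra|nra]).
  set (e1 := Rmin (/ 2) (e2 / (4 * (M + 1)))).
  assert (He1 : 0 < e1) by (apply Rmin_pos; [lra|apply Rdiv_lt_0_compat; lra]).
  assert (He1a : e1 <= / 2) by apply Rmin_l.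
  assert (He1b : 2 * (M + 1) * e1 <= e2 / 2).
  { apply Rle_trans with (2 * (M + 1) * (e2 / (4 * (M + 1)))).
    - apply Rmult_le_compat_l; [lra|apply Rmin_r].
    - right. field. lra. }
  destruct (pow_lt_1_zero t ltac:(rewrite Rabs_pos_eq; lra) (e2 / (2 * (M + 1))))
    as [N HN]; [apply Rdiv_lt_0_compat; lra|].
  specialize (HN N (le_n N)). rewrite Rabs_pos_eq in HN by (apply pow_le; lra).
  assert (HtN : M * t ^ N <= e2 / 2).
  { apply Rle_trans with ((M + 1) * (e2 / (2 * (M + 1)))).
    - apply Rmult_le_compat; try lra. apply pow_le; lra.
    - right. field. lra. }
  assert (HgP : 0 < Cmod (g - zeta0)).
  { apply Cmod_gt_0. intros E. apply Hgz. replace g with (g - zeta0 + zeta0)%C by ring.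
    rewrite E. ring. }
  assert (HNpos := pos_INR N).
  (* The cap has to miss the gap and to be small on the scale [del]. The last term makes [1 - Y ^ N]
     small within [9 * eta] of [zeta0]: 8 for the direction, 1 for [1 - r]. *)
  set (eta := Rmin (Cmod (g - zeta0) / 4) (Rmin (del / 8) (e2 / (36 * (INR N + 1) * (M + 1))))).
  assert (Hden : 0 < 36 * (INR N + 1) * (M + 1)) by (apply Rmult_lt_0_compat; lra).
  assert (He : 0 < eta).
  { apply Rmin_pos; [lra|apply Rmin_pos; [lra|]]. apply Rdiv_lt_0_compat; lra. }
  assert (Heg : 4 * eta <= Cmod (g - zeta0)).
  { assert (eta <= Cmod (g - zeta0) / 4) by apply Rmin_l. lra. }
  assert (Hed : 8 * eta <= del).
  { assert (eta <= del / 8) by (eapply Rle_trans; [apply Rmin_r|apply Rmin_l]). lra. }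
  assert (HeN : M * (2 * (INR N * (9 * eta))) <= e2 / 2).
  { apply Rle_trans with (eta * (36 * (INR N + 1) * (M + 1)) / 2).
    - assert (0 <= eta * INR N) by (apply Rmult_le_pos; lra). nra.
    - apply Rmult_le_compat_r; [lra|].
      apply Rle_trans with (e2 / (36 * (INR N + 1) * (M + 1)) * (36 * (INR N + 1) * (M + 1))).
      + apply Rmult_le_compat_r; [lra|].
        eapply Rle_trans; [apply Rmin_r|apply Rmin_r].
      + right. field. lra. }
  clearbody eta.
  destruct (Hcap eta He) as (sA & HsA & HAeta).
  set (s' := Rmax t sA).
  assert (Hs' : s' < 1) by (apply Rmax_lub_lt; lra).
  (* [X] aims at 1 on the scale [4 * eta], hence is close to 1 at directions at least [8 * eta] from
     [zeta0]. [Z] aims at [v - c0], of modulus at most [2 * V], on the scale [del / 2]. *)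
  destruct (kernel_approximation zeta0 g kappa s' eta (4 * eta) e1 1)
    as (rX & HrX & HX); trivial; try lra.
  destruct (kernel_approximation zeta0 g kappa s' eta (del / 2) e1 (2 * V))
    as (rZ & HrZ & HZ); trivial; try lra.
  assert (Hm : exists m, (N0 <= m)%nat /\ rX < rho m /\ rZ < rho m /\ 1 - eta < rho m).
  { assert (Hev := Hlim). apply is_lim_seq_spec in Hev. simpl in Hev.
    assert (Hgap : 0 < Rmin (1 - rX) (Rmin (1 - rZ) eta)) by (repeat apply Rmin_pos; lra).
    destruct (Hev (mkposreal _ Hgap)) as [n Hn]. simpl in Hn.
    exists (Nat.max N0 n). split; [lia|].
    specialize (Hn (Nat.max N0 n) ltac:(lia)). apply Rabs_lt_between in Hn.
    assert (I1 : Rmin (1 - rX) (Rmin (1 - rZ) eta) <= 1 - rX) by apply Rmin_l.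
    assert (I2 : Rmin (1 - rX) (Rmin (1 - rZ) eta) <= 1 - rZ)
      by (eapply Rle_trans; [apply Rmin_r|apply Rmin_l]).
    assert (I3 : Rmin (1 - rX) (Rmin (1 - rZ) eta) <= eta)
      by (eapply Rle_trans; [apply Rmin_r|apply Rmin_r]).
    lra. }
  destruct Hm as (m & HmN & HmX & HmZ & Hme). assert (Hrm := Hrho m).
  set (r := rho m) in *.
  set (far := fun (f : C -> C) zeta =>
    if Rlt_dec (Cmod (zeta - zeta0)) (4 * eta) then RtoC 0 else f zeta).
  destruct (HX r ltac:(lra) (far (fun _ => RtoC 1))) as (X & HX1 & HX2).
  { intros zeta _. unfold far. destruct Rlt_dec; rewrite ?Cmod_0, ?Cmod_1; lra. }
  { intros zeta _ Hlt. unfold far. destruct Rlt_dec; [trivial|lra]. }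
  destruct (HZ r ltac:(lra) (far (fun zeta => v zeta - c0)%C)) as (Z & HZ1 & HZ2).
  { intros zeta Hz. unfold far. destruct Rlt_dec; [rewrite Cmod_0; lra|].
    eapply Rle_trans; [apply Cmod_minus_triangle|]. specialize (HV zeta Hz). lra. }
  { intros zeta _ Hlt. unfold far. destruct Rlt_dec; [trivial|lra]. }
  destruct (peval_monomial (Cconj zeta0) N) as [YN HYN].
  set (P := padd (pmul (padd (c0 :: nil) (pscal (RtoC (-1)) S))
                       (padd YN (pmul (padd (RtoC 1 :: nil) (pscal (RtoC (-1)) YN)) X))) Z).
  assert (HP : forall z, peval P z
    = ((c0 - peval S z) * ((Cconj zeta0 * z) ^ N + (1 - (Cconj zeta0 * z) ^ N) * peval X z)
       + peval Z z)%C).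
  { intros z. unfold P. rewrite peval_padd, peval_pmul, peval_padd, (peval_padd YN),
      peval_pmul, (peval_padd (RtoC 1 :: nil)), !peval_pscal, HYN. simpl. ring. }
  assert (HY : forall z, Cmod z <= 1 -> Cmod (Cconj zeta0 * z) <= 1).
  { intros z Hz. rewrite Cmod_mult, Cmod_conj, Hz0. lra. }
  assert (HY2 : forall z, Cmod z <= 1 -> Cmod ((Cconj zeta0 * z) ^ N) <= 1).
  { intros z Hz. rewrite Cmod_pow, <- (pow1 N). apply pow_incr.
    split; [apply Cmod_ge_0|apply HY; trivial]. }
  assert (HSc : forall z, Cmod z <= 1 -> Cmod (c0 - peval S z) <= M).
  { intros z Hz. eapply Rle_trans; [apply Cmod_minus_triangle|].
    specialize (HB z Hz). unfold M. lra. }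
  assert (HPb : forall z yb, Cmod z <= 1 -> Cmod z <= s' \/ Cmod (z - zeta0) <= eta ->
    Cmod ((Cconj zeta0 * z) ^ N) <= yb -> Cmod (peval P z) <= M * (yb + 2 * e1) + e1).
  { intros z yb Hz Hz2 Hyb. rewrite HP.
    eapply Rle_trans; [apply Cmod_triangle|].
    apply Rplus_le_compat; [|apply HZ1; trivial].
    rewrite Cmod_mult. apply Rmult_le_compat; auto using Cmod_ge_0.
    eapply Rle_trans; [apply Cmod_triangle|]. apply Rplus_le_compat; trivial.
    rewrite Cmod_mult. apply Rmult_le_compat; auto using Cmod_ge_0.
    eapply Rle_trans; [apply Cmod_minus_triangle|]. rewrite Cmod_1.
    specialize (HY2 z Hz). lra. }
  exists m, P. split; [trivial|]. split; [|split].
  - assert (Hc := cauchy_estimate s t e2 P ltac:(lra) ltac:(lra)).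
    assert (pnorm s P * (t - s) <= e2 * t).
    { apply Hc. intros z Hz.
      apply Rle_trans with (M * (t ^ N + 2 * e1) + e1).
      - apply HPb; [lra|left; rewrite Hz; apply Rmax_l|].
        rewrite Cmod_pow, Cmod_mult, Cmod_conj, Hz0, Hz, Rmult_1_l. lra.
      - nra. }
    apply (Rmult_le_reg_r (t - s)); [lra|]. fold e2. nra.
  - intros z Hz. assert (Hz1 := HA z Hz). unfold unit_disc in Hz1.
    apply Rle_trans with (M * (1 + 2 * e1) + e1); [|nra].
    apply HPb; [lra| |apply HY2; lra].
    destruct (Rle_dec (Cmod z) s') as [H|H]; [left; trivial|right].
    apply HAeta; trivial. apply Rle_lt_trans with s'; [apply Rmax_r|lra].
  - intros w c b Hw Hwg Hc Hb.
    set (z := (RtoC r * w)%C).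
    assert (Hz : Cmod z = r) by (unfold z; rewrite Cmod_scal_R, Hw; lra).
    assert (HZc : Cmod (peval Z z - (c - c0)) <= b + e1).
    { apply HZ2; trivial.
      - eapply Rle_trans; [apply Cmod_minus_triangle|]. lra.
      - intros zeta Hzeta Hzw. unfold far. destruct Rlt_dec as [Hl|Hl].
        (* Where the cut-off acts, [zeta0] lies within [4 * eta + del / 2 <= del] of [w], so [c0]
           itself is within [b] of [c]. *)
        + replace (0 - (c - c0))%C with (v zeta0 - c)%C by (unfold c0; ring).
          apply Hb; trivial. assert (G := Cmod_triangle_mid zeta zeta0 w).
          rewrite (Cmod_minus_sym zeta0 zeta) in G. lra.
        + replace (v zeta - c0 - (c - c0))%C with (v zeta - c)%C by ring.
          apply Hb; trivial. lra. }
    fold r. fold z. rewrite peval_padd, HP.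
    replace (peval S z + ((c0 - peval S z) * ((Cconj zeta0 * z) ^ N
               + (1 - (Cconj zeta0 * z) ^ N) * peval X z) + peval Z z) - c)%C
      with ((c0 - peval S z) * ((1 - (Cconj zeta0 * z) ^ N) * (peval X z - 1))
            + (peval Z z - (c - c0)))%C by ring.
    eapply Rle_trans; [apply Cmod_triangle|]. rewrite !Cmod_mult.
    assert (HS1 := HSc z ltac:(lra)).
    (* Nearer than [8 * eta] the factor [1 - Y ^ N] is small and a crude bound for [X - 1] suffices;
       farther away [X - 1] is small and [1 - Y ^ N] is at most 2. *)
    destruct (Rlt_dec (Cmod (w - zeta0)) (8 * eta)) as [Hn|Hn].
    + assert (HX3 : Cmod (peval X z - 1) <= 1 + e1).
      { apply HX2; trivial; [rewrite Cmod_1; lra|].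
        intros zeta _ _. unfold far. destruct Rlt_dec.
        - rewrite Cmod_minus_sym. replace (1 - 0)%C with (RtoC 1) by ring.
          rewrite Cmod_1. lra.
        - replace (1 - 1)%C with (RtoC 0) by ring. rewrite Cmod_0. lra. }
      assert (Hy : Cmod (1 - (Cconj zeta0 * z) ^ N) <= INR N * (9 * eta)).
      { eapply Rle_trans; [apply Cmod_one_minus_pow, HY; lra|].
        apply Rmult_le_compat_l; trivial.
        rewrite <- (Cmod_1_conj zeta0) by trivial.
        replace (zeta0 * Cconj zeta0 - Cconj zeta0 * z)%C
          with (Cconj zeta0 * (zeta0 - z))%C by ring.
        rewrite Cmod_mult, Cmod_conj, Hz0, Cmod_minus_sym, Rmult_1_l.
        unfold z. assert (G := Cmod_triangle_mid w (RtoC r * w) zeta0).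
        replace (RtoC r * w - w)%C with (- (RtoC (1 - r) * w))%C in G
          by (rewrite RtoC_minus; ring).
        rewrite Cmod_opp in G. rewrite Cmod_scal_R, Hw in G by lra. lra. }
      assert (Cmod (c0 - peval S z)
        * (Cmod (1 - (Cconj zeta0 * z) ^ N) * Cmod (peval X z - 1)) <= e2 / 2).
      { apply Rle_trans with (2 := HeN). apply Rmult_le_compat; trivial.
        - apply Cmod_ge_0.
        - apply Rmult_le_pos; apply Cmod_ge_0.
        - rewrite (Rmult_comm 2). apply Rmult_le_compat; trivial; try apply Cmod_ge_0. lra. }
      nra.
    + assert (HX3 : Cmod (peval X z - 1) <= 0 + e1).
      { apply HX2; trivial; [rewrite Cmod_1; lra|].
        intros zeta _ Hzw. unfold far. destruct Rlt_dec as [Hl|Hl].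
        - assert (G := Cmod_triangle_mid zeta w zeta0).
          rewrite (Cmod_minus_sym w zeta) in G. lra.
        - replace (1 - 1)%C with (RtoC 0) by ring. rewrite Cmod_0. lra. }
      assert (Hy : Cmod (1 - (Cconj zeta0 * z) ^ N) <= 2).
      { eapply Rle_trans; [apply Cmod_minus_triangle|]. rewrite Cmod_1.
        specialize (HY2 z ltac:(lra)). lra. }
      assert (Cmod (c0 - peval S z)
        * (Cmod (1 - (Cconj zeta0 * z) ^ N) * Cmod (peval X z - 1)) <= M * (2 * e1)).
      { apply Rmult_le_compat; trivial.
        - apply Cmod_ge_0.
        - apply Rmult_le_pos; apply Cmod_ge_0.
        - apply Rmult_le_compat; trivial; try apply Cmod_ge_0. lra. }
      nra.
Qed.

(** * Limits of rapidly converging polynomials *)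

Lemma half_pow_pos n : 0 < (/ 2) ^ n.
Proof. apply pow_lt. lra. Qed.

Lemma half_pow_small eps : 0 < eps -> exists N, forall n, (N <= n)%nat -> (/ 2) ^ n <= eps.
Proof.
  intros He. destruct (pow_lt_1_zero (/ 2) ltac:(rewrite Rabs_pos_eq; lra) eps He) as [N HN].
  exists N. intros n Hn. specialize (HN n Hn).
  rewrite Rabs_pos_eq in HN by (apply Rlt_le, half_pow_pos). lra.
Qed.

(** The numbers [x j - c * (/ 2) ^ j] increase and [x j + c * (/ 2) ^ j] decrease; the supremum of
    the former is a limit with the rate built in. *)
Lemma geometric_limit_R (x : nat -> R) c j0 :
  (forall j, (j0 <= j)%nat -> Rabs (x (S j) - x j) <= c * (/ 2) ^ S j) ->
  exists L, forall j, (j0 <= j)%nat -> Rabs (x j - L) <= c * (/ 2) ^ j.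
Proof.
  intros H.
  assert (Hm : forall j k, (j0 <= j)%nat -> (j <= k)%nat ->
    x j - c * (/ 2) ^ j <= x k - c * (/ 2) ^ k /\ x k + c * (/ 2) ^ k <= x j + c * (/ 2) ^ j).
  { intros j k Hj Hk. induction Hk as [|k Hk IH]; [lra|].
    specialize (H k ltac:(lia)). apply Rabs_le_between in H. simpl pow in *. lra. }
  assert (Hc : 0 <= c).
  { specialize (H j0 (le_n j0)). assert (G := Rabs_pos (x (S j0) - x j0)).
    assert (P := half_pow_pos (S j0)). nra. }
  assert (Hle : forall j k, (j0 <= j)%nat -> (j0 <= k)%nat ->
    x j - c * (/ 2) ^ j <= x k + c * (/ 2) ^ k).
  { intros j k Hj Hk. destruct (Hm j (Nat.max j k) Hj (Nat.le_max_l _ _)) as [H1 _].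
    destruct (Hm k (Nat.max j k) Hk (Nat.le_max_r _ _)) as [_ H2].
    assert (P := half_pow_pos (Nat.max j k)). nra. }
  destruct (completeness (fun y => exists j, (j0 <= j)%nat /\ y = x j - c * (/ 2) ^ j))
    as [L [HL1 HL2]].
  - exists (x j0 + c * (/ 2) ^ j0). intros y (j & Hj & ->). apply Hle; auto.
  - exists (x j0 - c * (/ 2) ^ j0). exists j0. auto.
  - exists L. intros j Hj. apply Rabs_le_between.
    assert (x j - c * (/ 2) ^ j <= L) by (apply HL1; exists j; auto).
    assert (L <= x j + c * (/ 2) ^ j).
    { apply HL2. intros y (k & Hk & ->). apply Hle; auto. }
    lra.
Qed.

Lemma Cmod_le_Re_Im z : Cmod z <= Rabs (Re z) + Rabs (Im z).
Proof.
  apply Rsqr_incr_0; [|apply Cmod_ge_0|].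
  - rewrite !Rsqr_pow2, Cmod2_alt, <- (pow2_abs (Re z)), <- (pow2_abs (Im z)).
    assert (H1 := Rabs_pos (Re z)). assert (H2 := Rabs_pos (Im z)). nra.
  - assert (H1 := Rabs_pos (Re z)). assert (H2 := Rabs_pos (Im z)). lra.
Qed.

Lemma im_le_Cmod z : Rabs (Im z) <= Cmod z.
Proof.
  eapply Rle_trans; [apply Rmax_r|]. apply (Rmax_Cmod z).
Qed.

Lemma geometric_limit_C (a : nat -> C) c j0 :
  (forall j, (j0 <= j)%nat -> Cmod (a (S j) - a j) <= c * (/ 2) ^ S j) ->
  exists L, forall j, (j0 <= j)%nat -> Cmod (a j - L) <= 2 * c * (/ 2) ^ j.
Proof.
  intros H.
  destruct (geometric_limit_R (fun j => Re (a j)) c j0) as [L1 H1].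
  { intros j Hj. apply Rle_trans with (2 := H j Hj). apply (re_le_Cmod (a (S j) - a j)). }
  destruct (geometric_limit_R (fun j => Im (a j)) c j0) as [L2 H2].
  { intros j Hj. apply Rle_trans with (2 := H j Hj). apply (im_le_Cmod (a (S j) - a j)). }
  exists (L1, L2). intros j Hj.
  eapply Rle_trans; [apply Cmod_le_Re_Im|].
  specialize (H1 j Hj). specialize (H2 j Hj).
  change (Re (a j - (L1, L2))) with (Re (a j) - L1).
  change (Im (a j - (L1, L2))) with (Im (a j) - L2). lra.
Qed.

Lemma is_derive_quadratic (f : C -> C) x L K d : 0 < d ->
  (forall y, Cmod (y - x) < d -> Cmod (f y - f x - L * (y - x)) <= K * Cmod (y - x) ^ 2) ->
  is_derive (K := C_AbsRing) (V := C_NormedModule) f x L.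
Proof.
  intros Hd H. split.
  - apply is_linear_scal_l.
  - intros y Hy.
    assert (E : x = y).
    { apply (is_filter_lim_locally_unique (K := C_AbsRing) (V := AbsRing_NormedModule C_AbsRing)).
      exact Hy. }
    subst y. intros eps.
    set (K' := 1 + Rabs K). assert (HK' : 0 < K') by (unfold K'; assert (G := Rabs_pos K); lra).
    assert (He : 0 < Rmin d (eps / K')).
    { apply Rmin_pos; trivial. apply Rdiv_lt_0_compat; [apply cond_pos|trivial]. }
    exists (mkposreal _ He). intros y Hy2.
    change (Cmod (y - x) < Rmin d (eps / K')) in Hy2.
    change (Cmod (f y - f x - (y - x) * L) <= eps * Cmod (y - x)).
    rewrite (Cmult_comm (y - x)).
    eapply Rle_trans; [apply H; apply Rlt_le_trans with (1 := Hy2), Rmin_l|].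
    assert (H2 : Cmod (y - x) <= eps / K')
      by (apply Rlt_le, Rlt_le_trans with (1 := Hy2), Rmin_r).
    assert (H0 := Cmod_ge_0 (y - x)).
    assert (H3 : K' * Cmod (y - x) <= eps).
    { apply Rle_trans with (K' * (eps / K')); [apply Rmult_le_compat_l; lra|right; field; lra]. }
    assert (K <= K') by (unfold K'; assert (G := Rle_abs K); lra).
    replace (K * Cmod (y - x) ^ 2) with (K * Cmod (y - x) * Cmod (y - x)) by ring.
    apply Rmult_le_compat_r; trivial. nra.
Qed.

Lemma peval_taylor_le t s l x y N : Cmod x <= t -> Cmod y <= t -> t < s -> pnorm s l <= N ->
  Cmod (peval l y - peval l x - pder l x * (y - x)) <= Cmod (y - x) ^ 2 * (N / (s - t) ^ 2).
Proof.
  intros Hx Hy Hts HN.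
  assert (H := peval_taylor t s l x y Hx Hy Hts).
  assert (Hp : 0 < (s - t) ^ 2) by (apply pow_lt; lra).
  apply (Rmult_le_reg_r ((s - t) ^ 2)); trivial.
  replace (Cmod (y - x) ^ 2 * (N / (s - t) ^ 2) * (s - t) ^ 2)
    with (Cmod (y - x) ^ 2 * N) by (field; lra).
  assert (G := pow2_ge_0 (Cmod (y - x))).
  apply Rle_trans with (1 := H). apply Rmult_le_compat_l; trivial.
Qed.

(** The decay is asked of [pnorm], so that derivatives and Taylor remainders of the terms are
    summable along with the values. *)
Definition rapid (Q P : nat -> list C) (t : nat -> R) : Prop :=
  (forall j, Q (S j) = padd (Q j) (P j)) /\
  (forall j, t j <= t (S j)) /\
  (forall s, s < 1 -> exists j, s <= t j) /\
  (forall j, pnorm (t j) (P j) <= (/ 2) ^ S j).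

Lemma rapid_radii_mono Q P t j k : rapid Q P t -> (j <= k)%nat -> t j <= t k.
Proof. intros (_ & Ht_incr & _) H. induction H as [|k H IH]; [lra|]. specialize (Ht_incr k). lra. Qed.

Lemma rapid_limit Q P t : rapid Q P t -> exists f : C -> C, forall z j, Cmod z <= t j ->
  forall k, (j <= k)%nat -> Cmod (peval (Q k) z - f z) <= 2 * (/ 2) ^ k.
Proof.
  intros HR. assert (HR' := HR). destruct HR' as (HQ & _ & _ & HP).
  assert (H : forall z, exists L, forall j, Cmod z <= t j ->
    forall k, (j <= k)%nat -> Cmod (peval (Q k) z - L) <= 2 * (/ 2) ^ k).
  { intros z. destruct (Classical_Prop.classic (exists j, Cmod z <= t j)) as [Hj|Hn].
    2: { exists 0%C. intros j Hj. destruct Hn. exists j; trivial. }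
    (* Starting from the least admissible index gives one limit that serves every admissible [j]. *)
    destruct (Wf_nat.dec_inh_nat_subset_has_unique_least_element (fun j => Cmod z <= t j))
      as (j & [Hj1 Hj2] & _); trivial.
    { intros n. apply Classical_Prop.classic. }
    destruct (geometric_limit_C (fun k => peval (Q k) z) 1 j) as [L HL].
    - intros k Hk. rewrite HQ, peval_padd.
      replace (peval (Q k) z + peval (P k) z - peval (Q k) z)%C with (peval (P k) z) by ring.
      rewrite Rmult_1_l. apply Rle_trans with (2 := HP k). apply Cmod_peval.
      apply Rle_trans with (1 := Hj1), (rapid_radii_mono _ _ _ _ _ HR); trivial.
    - exists L. intros i Hi k Hk. rewrite <- (Rmult_1_r 2) at 1. apply HL.
      specialize (Hj2 i Hi). lia. }
  apply functional_choice in H. exact H.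
Qed.

(** The second-order Taylor remainders of the partial sums are bounded uniformly in [k], so the
    bound passes to the limit and [is_derive_quadratic] applies. *)
Lemma rapid_limit_holomorphic Q P t (f : C -> C) : rapid Q P t ->
  (forall z j, Cmod z <= t j ->
     forall k, (j <= k)%nat -> Cmod (peval (Q k) z - f z) <= 2 * (/ 2) ^ k) ->
  holo_disc f.
Proof.
  intros HR Hf x Hx. unfold unit_disc in Hx.
  assert (HR' := HR). destruct HR' as (HQ & Ht_incr & Ht_lim & HP).
  set (u := (1 + Cmod x) / 2). assert (Hu : Cmod x < u < 1) by (unfold u; lra).
  set (s := (1 + u) / 2). assert (Hs : u < s < 1) by (unfold s; lra).
  destruct (Ht_lim s ltac:(lra)) as [j Hj].
  assert (Htk : forall k, (j <= k)%nat -> s <= t k).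
  { intros k Hk. apply Rle_trans with (1 := Hj), (rapid_radii_mono _ _ _ _ _ HR); trivial. }
  destruct (geometric_limit_C (fun k => pder (Q k) x) (/ (s - u)) j) as [L HL].
  { intros k Hk. rewrite HQ, pder_padd.
    replace (pder (Q k) x + pder (P k) x - pder (Q k) x)%C with (pder (P k) x) by ring.
    specialize (Htk k Hk).
    assert (G := Cmod_pder u (t k) (P k) x ltac:(lra) ltac:(lra)).
    assert (G0 := Cmod_ge_0 (pder (P k) x)). specialize (HP k).
    apply (Rmult_le_reg_r (s - u)); [lra|].
    replace (/ (s - u) * (/ 2) ^ S k * (s - u)) with ((/ 2) ^ S k) by (field; lra).
    nra. }
  set (K0 := pnorm 1 (Q j) / (1 - u) ^ 2). set (c := 1 / (s - u) ^ 2).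
  assert (Hc : 0 < c) by (apply Rdiv_lt_0_compat; [lra|apply pow_lt; lra]).
  exists L. apply (is_derive_quadratic f x L (K0 + c) (u - Cmod x)); [lra|].
  intros y Hy.
  assert (Hyu : Cmod y <= u) by (assert (G := Cmod_triangle_rev y x); lra).
  assert (Hd := pow2_ge_0 (Cmod (y - x))).
  (* [K0] accounts for [Q j], and passing from [k] to [S k] adds at most [c * (/ 2) ^ S k], which is
     the growth of the bound. *)
  assert (Hk : forall k, (j <= k)%nat ->
    Cmod (peval (Q k) y - peval (Q k) x - pder (Q k) x * (y - x))
    <= Cmod (y - x) ^ 2 * (K0 + c * (1 - (/ 2) ^ k))).
  { intros k Hk. induction Hk as [|k Hk IH].
    - apply Rle_trans with (Cmod (y - x) ^ 2 * K0).
      + apply peval_taylor_le; lra.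
      + apply Rmult_le_compat_l; trivial.
        assert ((/ 2) ^ j <= 1) by (rewrite <- (pow1 j); apply pow_incr; lra).
        assert (0 <= c * (1 - (/ 2) ^ j)) by (apply Rmult_le_pos; lra). lra.
    - rewrite HQ, !peval_padd, pder_padd.
      replace (peval (Q k) y + peval (P k) y - (peval (Q k) x + peval (P k) x)
               - (pder (Q k) x + pder (P k) x) * (y - x))%C
        with ((peval (Q k) y - peval (Q k) x - pder (Q k) x * (y - x))
              + (peval (P k) y - peval (P k) x - pder (P k) x * (y - x)))%C by ring.
      eapply Rle_trans; [apply Cmod_triangle|].
      assert (Hsk := Htk k Hk).
      assert (G := peval_taylor_le u (t k) (P k) x y _ ltac:(lra) Hyu ltac:(lra) (HP k)).
      assert (G2 : (/ 2) ^ S k / (t k - u) ^ 2 <= c * (/ 2) ^ S k).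
      { unfold c, Rdiv. rewrite Rmult_1_l, Rmult_comm.
        apply Rmult_le_compat_r; [apply Rlt_le, half_pow_pos|].
        apply Rinv_le_contravar; [apply pow_lt; lra|apply pow_incr; lra]. }
      assert (G3 : Cmod (y - x) ^ 2 * ((/ 2) ^ S k / (t k - u) ^ 2)
                   <= Cmod (y - x) ^ 2 * (c * (/ 2) ^ S k))
        by (apply Rmult_le_compat_l; trivial).
      assert (E : (/ 2) ^ k = 2 * (/ 2) ^ S k) by (simpl; field).
      rewrite E in IH. nra. }
  apply le_epsilon. intros eps He.
  set (M := 4 + 2 * / (s - u) * Cmod (y - x)).
  assert (HM : 0 < M).
  { unfold M. assert (0 < / (s - u)) by (apply Rinv_0_lt_compat; lra).
    assert (0 <= 2 * / (s - u) * Cmod (y - x))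
      by (apply Rmult_le_pos; [lra|apply Cmod_ge_0]). lra. }
  destruct (half_pow_small (eps / M)) as [n Hn]; [apply Rdiv_lt_0_compat; lra|].
  set (k := Nat.max n j).
  specialize (Hn k ltac:(lia)). specialize (Hk k ltac:(lia)).
  specialize (HL k ltac:(lia)).
  assert (Fy := Hf y j ltac:(lra) k ltac:(lia)).
  assert (Fx := Hf x j ltac:(lra) k ltac:(lia)).
  assert (HMn : M * (/ 2) ^ k <= eps).
  { apply Rle_trans with (M * (eps / M)); [apply Rmult_le_compat_l; lra|right; field; lra]. }
  assert (Hcp : c * (1 - (/ 2) ^ k) <= c).
  { assert (P0 := half_pow_pos k). nra. }
  replace (f y - f x - L * (y - x))%C
    with ((peval (Q k) y - peval (Q k) x - pder (Q k) x * (y - x))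
          + ((pder (Q k) x - L) * (y - x)
             + ((peval (Q k) x - f x) - (peval (Q k) y - f y))))%C by ring.
  eapply Rle_trans; [apply Cmod_triangle|].
  assert (T1 := Cmod_triangle ((pder (Q k) x - L) * (y - x))
             ((peval (Q k) x - f x) - (peval (Q k) y - f y))).
  assert (T2 := Cmod_minus_triangle (peval (Q k) x - f x) (peval (Q k) y - f y)).
  rewrite Cmod_mult in T1.
  assert (T3 : Cmod (pder (Q k) x - L) * Cmod (y - x)
               <= 2 * / (s - u) * (/ 2) ^ k * Cmod (y - x))
    by (apply Rmult_le_compat_r; [apply Cmod_ge_0|trivial]).
  assert (T4 : Cmod (y - x) ^ 2 * (K0 + c * (1 - (/ 2) ^ k)) <= (K0 + c) * Cmod (y - x) ^ 2)
    by (rewrite Rmult_comm; apply Rmult_le_compat_r; lra).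
  unfold M in HMn. lra.
Qed.

(** * The inductive construction *)

Lemma threshold_radius (w : R -> R) M s : filterlim w (at_left 1) (Rbar_locally p_infty) ->
  s < 1 -> exists t, s <= t < 1 /\ M < w t.
Proof.
  intros Hw Hs. destruct (Hw (fun x => M < x)) as [d Hd].
  { exists M. auto. }
  assert (Hd0 := cond_pos d).
  exists (Rmax s (1 - d / 2)).
  assert (H1 : s <= Rmax s (1 - d / 2)) by apply Rmax_l.
  assert (H2 : 1 - d / 2 <= Rmax s (1 - d / 2)) by apply Rmax_r.
  assert (H3 : Rmax s (1 - d / 2) < 1) by (apply Rmax_lub_lt; lra).
  split; [lra|]. apply Hd; trivial.
  change (Rabs (Rmax s (1 - d / 2) - 1) < d). apply Rabs_lt_between. lra.
Qed.

(** On [A] the new term is paid for in two ways: up to radius [t] by half of the slack [(/ 2) ^ j],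
    beyond [t] by [w], which exceeds the bounds of [S0] and of the new term together. The next
    radius [s'] is at least [rho m], so that later terms hardly disturb the approximation there. *)
Lemma universal_step (rho : nat -> R) (A : C -> Prop) zeta0 (w : R -> R)
  (S0 : list C) s j (v : C -> C) V g kappa del :
  (forall n, 0 <= rho n < 1) -> is_lim_seq rho 1 ->
  (forall z, A z -> unit_disc z) -> Cmod zeta0 = 1 ->
  (forall eta, 0 < eta -> exists s, s < 1 /\
     forall z, A z -> s < Cmod z -> Cmod (z - zeta0) <= eta) ->
  (forall x y, 0 <= x -> x < y -> y < 1 -> w x < w y) ->
  filterlim w (at_left 1) (Rbar_locally p_infty) ->
  (forall zeta, Cmod zeta = 1 -> Cmod (v zeta) <= V) ->
  Cmod g = 1 -> 0 < kappa -> 0 < del -> 0 <= s < 1 ->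
  (forall z, A z -> Cmod (peval S0 z) <= w (Cmod z) - (/ 2) ^ j) ->
  exists (P : list C) (t s' : R),
    s <= t /\ 1 - (/ 2) ^ j <= t /\ t <= s' < 1 /\ pnorm t P <= (/ 2) ^ S j /\
    (forall z, A z -> Cmod (peval (padd S0 P) z) <= w (Cmod z) - (/ 2) ^ S j) /\
    (g <> zeta0 -> exists m, (j <= m)%nat /\ rho m <= s' /\
      forall w c b, Cmod w = 1 -> kappa <= Cmod (w - g) -> Cmod c <= V ->
       (forall zeta, Cmod zeta = 1 -> Cmod (zeta - w) <= del -> Cmod (v zeta - c) <= b) ->
       Cmod (peval (padd S0 P) (RtoC (rho m) * w) - c) <= b + (/ 2) ^ j).
Proof.
  intros Hrho Hlim HA Hz0 Hcap Hincr Hwl HV Hg Hk Hd Hs Hinv.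
  assert (Hj := half_pow_pos (S j)).
  assert (Ej : (/ 2) ^ j = 2 * (/ 2) ^ S j) by (simpl; field).
  set (B := pnorm 1 S0). set (M := 2 * (V + B) + 1).
  assert (HB : forall z, Cmod z <= 1 -> Cmod (peval S0 z) <= B)
    by (intros; apply Cmod_peval; trivial).
  destruct (threshold_radius w (B + M + 1) (Rmax s (1 - (/ 2) ^ j)) Hwl) as (t & Ht & Hwt).
  { apply Rmax_lub_lt; lra. }
  assert (Ht1 : s <= t) by (apply Rle_trans with (2 := proj1 Ht), Rmax_l).
  assert (Ht2 : 1 - (/ 2) ^ j <= t) by (apply Rle_trans with (2 := proj1 Ht), Rmax_r).
  (* A gap at [zeta0] leaves no room for the cap; such a target is skipped with the zero
     polynomial. *)
  destruct (Classical_Prop.classic (g = zeta0)) as [E|Hne].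
  - exists nil, t, t. do 2 (split; [trivial|]). split; [lra|].
    split; [simpl; simpl in Hj; lra|]. split; [|contradiction].
    intros z Hz. rewrite peval_padd. simpl peval. rewrite Cplus_0_r.
    specialize (Hinv z Hz). lra.
  - destruct (correction_step rho A zeta0 Hrho Hlim HA Hz0 Hcap S0 v B V g kappa del
      ((/ 2) ^ S j) t j) as (m & P & Hm & HP & HPA & Happ); trivial; try lra.
    exists P, t, (Rmax t (rho m)). specialize (Hrho m).
    do 2 (split; [trivial|]).
    split; [split; [apply Rmax_l|apply Rmax_lub_lt; lra]|]. split; [trivial|]. split.
    + intros z Hz. rewrite peval_padd. eapply Rle_trans; [apply Cmod_triangle|].
      assert (Hz1 := HA z Hz). unfold unit_disc in Hz1.
      destruct (Rle_dec (Cmod z) t) as [Hzt|Hzt].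
      * specialize (Hinv z Hz). assert (G := Cmod_peval t P z Hzt). lra.
      * specialize (HPA z Hz). specialize (HB z ltac:(lra)).
        assert (G := Hincr t (Cmod z) ltac:(lra) ltac:(lra) Hz1).
        assert ((/ 2) ^ S j <= 1) by (rewrite <- (pow1 (S j)); apply pow_incr; lra).
        fold M in HPA. lra.
    + intros _. exists m. split; [trivial|]. split; [apply Rmax_r|].
      intros x c b Hx Hxg Hc Hb. specialize (Happ x c b Hx Hxg Hc Hb). lra.
Qed.

Lemma universal_function (rho : nat -> R) (A : C -> Prop) zeta0 (w : R -> R)
  (v : nat -> C -> C) (V : nat -> R) (g : nat -> C) (kappa del : nat -> R) :
  (forall n, 0 <= rho n < 1) -> is_lim_seq rho 1 ->
  (forall z, A z -> unit_disc z) -> Cmod zeta0 = 1 ->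
  (forall eta, 0 < eta -> exists s, s < 1 /\
     forall z, A z -> s < Cmod z -> Cmod (z - zeta0) <= eta) ->
  (forall x, 0 <= x < 1 -> 1 <= w x) ->
  (forall x y, 0 <= x -> x < y -> y < 1 -> w x < w y) ->
  filterlim w (at_left 1) (Rbar_locally p_infty) ->
  (forall j zeta, Cmod zeta = 1 -> Cmod (v j zeta) <= V j) ->
  (forall j, Cmod (g j) = 1) -> (forall j, 0 < kappa j) -> (forall j, 0 < del j) ->
  exists f, holo_disc f /\ (forall z, A z -> Cmod (f z) <= w (Cmod z)) /\
    forall j, g j <> zeta0 -> exists m, (j <= m)%nat /\
      forall w c b, Cmod w = 1 -> kappa j <= Cmod (w - g j) -> Cmod c <= V j ->
        (forall zeta, Cmod zeta = 1 -> Cmod (zeta - w) <= del j ->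
           Cmod (v j zeta - c) <= b) ->
        Cmod (f (RtoC (rho m) * w)%C - c) <= b + 2 * (/ 2) ^ j.
Proof.
  intros Hrho Hlim HA Hz0 Hcap Hw1 Hincr Hwl HV Hg Hk Hd.
  set (valid := fun j (S0 : list C) s => 0 <= s < 1 /\
    forall z, A z -> Cmod (peval S0 z) <= w (Cmod z) - (/ 2) ^ j).
  set (good := fun j (S0 : list C) s P t s' =>
    s <= t /\ 1 - (/ 2) ^ j <= t /\ t <= s' /\ pnorm t P <= (/ 2) ^ S j /\
    (g j <> zeta0 -> exists m, (j <= m)%nat /\ rho m <= s' /\
      forall w c b, Cmod w = 1 -> kappa j <= Cmod (w - g j) -> Cmod c <= V j ->
       (forall zeta, Cmod zeta = 1 -> Cmod (zeta - w) <= del j ->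
          Cmod (v j zeta - c) <= b) ->
       Cmod (peval (padd S0 P) (RtoC (rho m) * w) - c) <= b + (/ 2) ^ j)).
  (* The step is chosen for all states at once; an invalid state receives a dummy value, and
     [Hvalid] shows that none is reached. *)
  destruct (functional_choice (fun (x : nat * (list C * R)) (y : list C * R * R) =>
      let '(j, (S0, s)) := x in let '(P, t, s') := y in
      valid j S0 s -> good j S0 s P t s' /\ valid (S j) (padd S0 P) s')) as [F HF].
  { intros [j [S0 s]].
    destruct (Classical_Prop.classic (valid j S0 s)) as [[Hs Hinv]|Hn].
    2: { exists (nil, 0, 0). intros H. contradiction. }
    destruct (universal_step rho A zeta0 w S0 s j (v j) (V j) (g j) (kappa j) (del j))
      as (P & t & s' & H1 & H2 & H3 & H4 & H5 & H6); auto.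
    exists (P, t, s'). intros _. unfold good, valid. repeat split; trivial; lra. }
  set (st := fix st (j : nat) : list C * R :=
    match j with
    | O => (nil, 0)
    | S j' => (padd (fst (st j')) (fst (fst (F (j', st j')))), snd (F (j', st j')))
    end).
  set (Q := fun j => fst (st j)). set (rad := fun j => snd (st j)).
  set (P := fun j => fst (fst (F (j, st j)))). set (t := fun j => snd (fst (F (j, st j)))).
  assert (HF' : forall j, valid j (Q j) (rad j) ->
    good j (Q j) (rad j) (P j) (t j) (rad (S j)) /\ valid (S j) (Q (S j)) (rad (S j))).
  { intros j Hv. assert (G := HF (j, st j)). unfold Q, rad, P, t in *. simpl.
    destruct (st j) as [S0 s]. destruct (F (j, (S0, s))) as [[P0 t0] s0].
    simpl in *. apply G. exact Hv. }
  assert (Hvalid : forall j, valid j (Q j) (rad j)).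
  { induction j as [|j IH]; [|apply HF'; trivial].
    split; [unfold rad; simpl; lra|]. intros z Hz. simpl. rewrite Cmod_0.
    assert (G := HA z Hz). unfold unit_disc in G.
    specialize (Hw1 (Cmod z) (conj (Cmod_ge_0 z) G)). lra. }
  assert (Hgood : forall j, good j (Q j) (rad j) (P j) (t j) (rad (S j)))
    by (intros j; apply HF', Hvalid).
  assert (HR : rapid Q P t).
  { split; [reflexivity|]. split; [|split].
    - intros j. destruct (Hgood j) as (_ & _ & H1 & _). destruct (Hgood (S j)) as (H2 & _).
      lra.
    - intros s Hs. destruct (half_pow_small (1 - s)) as [j Hj]; [lra|].
      exists j. specialize (Hj j (le_n j)). destruct (Hgood j) as (_ & H & _). lra.
    - intros j. destruct (Hgood j) as (_ & _ & _ & H & _). exact H. }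
  destruct (rapid_limit Q P t HR) as [f Hf].
  exists f. split; [exact (rapid_limit_holomorphic Q P t f HR Hf)|]. split.
  - intros z Hz. assert (Hz1 := HA z Hz). unfold unit_disc in Hz1.
    destruct HR as (_ & _ & Htl & _). destruct (Htl (Cmod z) Hz1) as [j Hj].
    apply le_epsilon. intros eps He. destruct (half_pow_small eps He) as [n Hn].
    specialize (Hn (Nat.max n j) ltac:(lia)).
    specialize (Hf z j Hj (Nat.max n j) ltac:(lia)).
    destruct (Hvalid (Nat.max n j)) as [_ Hv]. specialize (Hv z Hz).
    assert (G := Cmod_triangle_rev (f z) (peval (Q (Nat.max n j)) z)).
    rewrite Cmod_minus_sym in G. lra.
  - intros j Hgj. destruct (Hgood j) as (_ & _ & _ & _ & H).
    destruct (H Hgj) as (m & Hm1 & Hm2 & Happ). exists m. split; [trivial|].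
    intros x c b Hx Hxg Hc Hb. specialize (Happ x c b Hx Hxg Hc Hb).
    assert (Hm := Hrho m).
    assert (Hx2 : Cmod (RtoC (rho m) * x) = rho m) by (rewrite Cmod_scal_R, Hx; lra).
    destruct (Hgood (S j)) as (H2 & _).
    (* The point has modulus at most [rad (S j) <= t (S j)], so the later terms cost at most
       [2 * (/ 2) ^ S j], a second [(/ 2) ^ j]. *)
    assert (G := Hf (RtoC (rho m) * x)%C (S j) ltac:(lra) (S j) (le_n _)).
    change (Q (S j)) with (padd (Q j) (P j)) in G.
    assert (T := Cmod_triangle_mid (peval (padd (Q j) (P j)) (RtoC (rho m) * x)%C)
       (f (RtoC (rho m) * x)%C) c).
    rewrite (Cmod_minus_sym (f _) (peval _ _)) in T. simpl pow in *. lra.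
Qed.

(** * A countable family of step functions on the circle *)

(** Iterated Cantor unpairing: one number codes a sequence, and every finite initial segment occurs,
    so a single index ranges over all finite data. *)
Fixpoint entry (n i : nat) : nat :=
  match i with
  | O => fst (Cantor.of_nat n)
  | S i' => entry (snd (Cantor.of_nat n)) i'
  end.

Lemma entry_surj M (c : nat -> nat) : exists n, forall i, (i <= M)%nat -> entry n i = c i.
Proof.
  revert c. induction M as [|M IH]; intros c.
  - exists (Cantor.to_nat (c 0%nat, 0%nat)). intros i Hi.
    replace i with 0%nat by lia. unfold entry. rewrite Cantor.cancel_of_to. reflexivity.
  - destruct (IH (fun i => c (S i))) as [n Hn].
    exists (Cantor.to_nat (c 0%nat, n)). intros [|i] Hi; unfold entry; fold entry;
      rewrite Cantor.cancel_of_to; simpl; trivial. apply Hn. lia.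
Qed.

(** The free zeroth entry forces a code to be large, so the same target returns at arbitrarily late
    steps. *)
Lemma entry_0_le n : (entry n 0 <= n)%nat.
Proof.
  unfold entry. destruct (Cantor.of_nat n) as [a b] eqn:E. simpl.
  rewrite <- (Cantor.cancel_to_of n), E.
  assert (G := Cantor.to_nat_non_decreasing a b). lia.
Qed.

Definition mesh (m : nat) : R := / (INR m + 1).

Lemma mesh_pos m : 0 < mesh m.
Proof. apply Rinv_0_lt_compat. assert (G := pos_INR m). lra. Qed.

Lemma mesh_le_1 m : mesh m <= 1.
Proof. unfold mesh. rewrite <- Rinv_1. apply Rinv_le_contravar; assert (G := pos_INR m); lra. Qed.

Lemma mesh_mult m : mesh m * (INR m + 1) = 1.
Proof. apply Rinv_l. assert (G := pos_INR m). lra. Qed.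

Lemma mesh_small eps : 0 < eps -> exists m0, forall m, (m0 <= m)%nat -> mesh m <= eps.
Proof.
  intros He. destruct (nfloor_ex (/ eps)) as [n Hn]; [apply Rlt_le, Rinv_0_lt_compat; trivial|].
  exists n. intros m Hm. unfold mesh. rewrite <- (Rinv_inv eps).
  apply Rinv_le_contravar; [apply Rinv_0_lt_compat; trivial|].
  apply le_INR in Hm. lra.
Qed.

(** Points of a square grid; a difference of two naturals stands for an integer. *)
Definition value (m k : nat) : C :=
  ((INR (entry k 0) - INR (entry k 1)) * mesh m,
   (INR (entry k 2) - INR (entry k 3)) * mesh m).

Lemma grid_approx m x : exists a b : nat, Rabs ((INR a - INR b) * mesh m - x) <= mesh m.
Proof.
  destruct (archimed (x * (INR m + 1))) as [H1 H2].
  set (z := up (x * (INR m + 1))) in *.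
  exists (Z.to_nat z), (Z.to_nat (- z)).
  assert (E : INR (Z.to_nat z) - INR (Z.to_nat (- z)) = IZR z).
  { rewrite !INR_IZR_INZ, <- minus_IZR. f_equal. lia. }
  rewrite E. assert (Hm := mesh_pos m). assert (Hmm := mesh_mult m).
  replace x with (x * (INR m + 1) * mesh m) by (rewrite Rmult_assoc, (Rmult_comm _ (mesh m)), Hmm; ring).
  rewrite <- Rmult_minus_distr_r, Rabs_mult, (Rabs_pos_eq (mesh m)) by lra.
  rewrite <- (Rmult_1_l (mesh m)) at 2. apply Rmult_le_compat_r; [lra|].
  replace (x * (INR m + 1) * mesh m * (INR m + 1)) with (x * (INR m + 1))
    by (rewrite (Rmult_assoc _ (mesh m)), Hmm; ring).
  rewrite Rabs_pos_eq; lra.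
Qed.

Lemma value_approx m (x : C) : exists k, Cmod (value m k - x) <= 2 * mesh m.
Proof.
  destruct (grid_approx m (Re x)) as (a & b & H1).
  destruct (grid_approx m (Im x)) as (c & d & H2).
  destruct (entry_surj 3 (fun i => nth i (a :: b :: c :: d :: nil) 0%nat)) as [k Hk].
  exists k. unfold value. rewrite !Hk by lia. simpl nth.
  eapply Rle_trans; [apply Cmod_le_Re_Im|].
  replace (2 * mesh m) with (mesh m + mesh m) by ring.
  apply Rplus_le_compat; [exact H1|exact H2].
Qed.

Lemma circle_net m : exists idx : C -> nat, forall zeta, Cmod zeta = 1 ->
  Cmod (zeta - cis (INR (idx zeta) * mesh m)) <= mesh m /\ (idx zeta <= 8 * (m + 1))%nat.
Proof.
  apply (functional_choice (fun zeta i => Cmod zeta = 1 ->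
    Cmod (zeta - cis (INR i * mesh m)) <= mesh m /\ (i <= 8 * (m + 1))%nat)).
  intros zeta. destruct (Req_dec (Cmod zeta) 1) as [H|H]; [|exists 0%nat; contradiction].
  destruct (arg_exists zeta H) as (t & Ht & ->).
  assert (Hm := mesh_pos m). assert (Hmm := mesh_mult m). assert (Hp := pos_INR m).
  destruct (nfloor_ex (t * (INR m + 1))) as [i Hi]; [apply Rmult_le_pos; lra|].
  exists i. intros _. split.
  - eapply Rle_trans; [apply cis_lipschitz|].
    replace t with (t * (INR m + 1) * mesh m)
      by (rewrite Rmult_assoc, (Rmult_comm _ (mesh m)), Hmm; ring).
    rewrite <- Rmult_minus_distr_r, Rabs_mult, (Rabs_pos_eq (mesh m)) by lra.
    rewrite <- (Rmult_1_l (mesh m)) at 2. apply Rmult_le_compat_r; [lra|].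
    rewrite Rabs_pos_eq; lra.
  (* The factor 8 is an upper bound for [2 * PI]. *)
  - apply INR_le. rewrite mult_INR, plus_INR. assert (G := PI_4). simpl. nra.
Qed.

Lemma gap_direction m zeta0 g0 : Cmod g0 = 1 ->
  exists a, cis (INR a * mesh m) <> zeta0 /\ Cmod (cis (INR a * mesh m) - g0) <= mesh m.
Proof.
  intros H. destruct (arg_exists g0 H) as (t & Ht & ->).
  assert (Hm := mesh_pos m). assert (Hm1 := mesh_le_1 m).
  assert (Hmm := mesh_mult m). assert (Hp := pos_INR m).
  destruct (nfloor_ex (t * (INR m + 1))) as [i Hi]; [apply Rmult_le_pos; lra|].
  assert (Et : t = t * (INR m + 1) * mesh m)
    by (rewrite Rmult_assoc, (Rmult_comm _ (mesh m)), Hmm; ring).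
  assert (Hn : forall a, Rabs (INR a - t * (INR m + 1)) <= 1 ->
    Cmod (cis (INR a * mesh m) - cis t) <= mesh m).
  { intros a Ha. eapply Rle_trans; [apply cis_lipschitz|]. rewrite Et.
    rewrite <- Rmult_minus_distr_r, Rabs_mult, (Rabs_pos_eq (mesh m)) by lra.
    rewrite <- (Rmult_1_l (mesh m)) at 2. apply Rmult_le_compat_r; lra. }
  (* Two consecutive net points lie within one mesh of the given point; they are distinct, so one of
     them differs from [zeta0]. *)
  destruct (Classical_Prop.classic (cis (INR i * mesh m) = zeta0)) as [E|E].
  - exists (S i). split.
    + intros E2. apply (cis_neq_1 (mesh m)).
      * assert (P2 := PI2_1). lra.
      * rewrite <- E, S_INR in E2.
        replace ((INR i + 1) * mesh m) with (INR i * mesh m + mesh m) in E2 by ring.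
        rewrite cis_plus in E2.
        assert (Hc : (cis (INR i * mesh m) * Cconj (cis (INR i * mesh m)) = 1)%C)
          by apply Cmod_1_conj, Cmod_cis.
        rewrite <- Hc at 1. rewrite <- E2 at 1.
        replace (cis (INR i * mesh m) * cis (mesh m) * Cconj (cis (INR i * mesh m)))%C
          with (cis (mesh m) * (cis (INR i * mesh m) * Cconj (cis (INR i * mesh m))))%C by ring.
        rewrite Hc. ring.
    + apply Hn. rewrite S_INR. apply Rabs_le_between. lra.
  - exists i. split; trivial. apply Hn. apply Rabs_le_between. lra.
Qed.

Lemma finite_bound (h : nat -> R) M : exists V, forall i, (i <= M)%nat -> h i <= V.
Proof.
  induction M as [|M [V HV]].
  - exists (h 0%nat). intros i Hi. replace i with 0%nat by lia. lra.
  - exists (Rmax V (h (S M))). intros i Hi.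
    destruct (Nat.eq_dec i (S M)) as [->|Hne]; [apply Rmax_r|].
    apply Rle_trans with V; [apply HV; lia|apply Rmax_l].
Qed.

(** * Compact subsets of the circle *)

(** The set is a disc or empty. A cover can thus be indexed by all pairs of a centre and a radius,
    unsuitable pairs giving the empty set, and the radii of a finite subcover remain available. *)
Lemma open_disc_and (k : C) r (P : Prop) : open (fun z : C => Cmod (z - k) < r /\ P).
Proof.
  intros x [Hx HP].
  assert (He : 0 < (r - Cmod (x - k)) / 2) by lra.
  exists (mkposreal _ He). intros y [H1 H2]. split; trivial.
  change (Rabs (Re (y - x)) < (r - Cmod (x - k)) / 2) in H1.
  change (Rabs (Im (y - x)) < (r - Cmod (x - k)) / 2) in H2.
  assert (G := Cmod_le_Re_Im (y - x)). assert (G2 := Cmod_triangle_mid x y k). lra.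
Qed.

Lemma list_min_pos {T : Type} (l : list (T * R)) :
  exists d, 0 < d /\ forall i, In i l -> 0 < snd i -> d <= snd i.
Proof.
  induction l as [|i l (d & Hd & H)]; [exists 1; simpl; split; [lra|tauto]|].
  destruct (Rlt_dec 0 (snd i)) as [Hi|Hi].
  - exists (Rmin d (snd i)). split; [apply Rmin_pos; trivial|].
    intros j [<-|Hj] Hj0; [apply Rmin_r|].
    apply Rle_trans with d; [apply Rmin_l|auto].
  - exists d. split; trivial. intros j [<-|Hj] Hj0; [lra|auto].
Qed.

Lemma compactC_away (K : C -> Prop) g0 : compactC K -> ~ K g0 ->
  exists d, 0 < d /\ forall z, K z -> d <= Cmod (z - g0).
Proof.
  intros HK Hg.
  destruct (HK (C * R)%type (fun i z => Cmod (z - fst i) < snd i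
                  /\ (0 < snd i /\ 2 * snd i <= Cmod (fst i - g0)))) as [l Hl].
  - intros i. apply open_disc_and.
  - intros z Hz. assert (Hp : 0 < Cmod (z - g0)).
    { apply Cmod_gt_0. intros E. apply Hg. replace g0 with (z - (z - g0))%C by ring.
      rewrite E. replace (z - 0)%C with z by ring. trivial. }
    exists (z, Cmod (z - g0) / 2). simpl.
    replace (z - z)%C with (RtoC 0) by ring. rewrite Cmod_0. lra.
  - destruct (list_min_pos l) as (d & Hd & Hmin). exists d. split; trivial.
    intros z Hz. destruct (Hl z Hz) as (i & Hi & H1 & H2 & H3).
    specialize (Hmin i Hi H2). assert (G := Cmod_triangle_mid z (fst i) g0).
    rewrite (Cmod_minus_sym (fst i) z) in G. lra.
Qed.

(** A Lebesgue number: [phi] varies little on discs of twice the covering radius, so a point near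
    [x] stays in the doubled disc that belongs to [x]. *)
Lemma compactC_uniform (K : C -> Prop) phi eps : compactC K -> continuous_onC K phi ->
  0 < eps -> exists d, 0 < d /\ forall x y, K x -> K y -> Cmod (x - y) <= d ->
    Cmod (phi x - phi y) <= eps.
Proof.
  intros HK Hphi He.
  destruct (HK (C * R)%type (fun i z => Cmod (z - fst i) < snd i
      /\ (0 < snd i /\ forall x, K x -> Cmod (x - fst i) < 2 * snd i ->
             Cmod (phi x - phi (fst i)) < eps / 2))) as [l Hl].
  - intros i. apply open_disc_and.
  - intros z Hz.
    destruct (Hphi z Hz (fun y => Cmod (y - phi z) < eps / 2)) as [d Hd].
    (* Basic neighbourhoods in [C] are squares, so each coordinate gets half of [eps / 2]. *)
    { assert (Hq : 0 < eps / 4) by lra. exists (mkposreal _ Hq). intros y [H1 H2].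
      change (Rabs (Re (y - phi z)) < eps / 4) in H1.
      change (Rabs (Im (y - phi z)) < eps / 4) in H2.
      assert (G := Cmod_le_Re_Im (y - phi z)). lra. }
    assert (Hd0 := cond_pos d).
    exists (z, d / 2). simpl. replace (z - z)%C with (RtoC 0) by ring. rewrite Cmod_0.
    split; [lra|]. split; [lra|]. intros x Hx Hxz.
    apply Hd; trivial. apply C_NormedModule_mixin_compat1.
    change (Cmod (x - z) < d). lra.
  - destruct (list_min_pos l) as (d & Hd & Hmin). exists d. split; trivial.
    intros x y Hx Hy Hxy. destruct (Hl x Hx) as (i & Hi & H1 & H2 & H3).
    specialize (Hmin i Hi H2).
    assert (G := Cmod_triangle_mid x y (fst i)). rewrite (Cmod_minus_sym y x) in G.
    assert (Gx := H3 x Hx ltac:(lra)). assert (Gy := H3 y Hy ltac:(lra)).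
    assert (T := Cmod_triangle_mid (phi (fst i)) (phi x) (phi y)).
    rewrite (Cmod_minus_sym (phi (fst i))) in T. lra.
Qed.

(* The code [n] carries: a free entry (so that every target recurs), the mesh, the gap,
   and the values of the step function on the cells of the net. *)
Definition step_fun (idx : nat -> C -> nat) (n : nat) (zeta : C) : C :=
  value (entry n 1) (entry n (3 + idx (entry n 1) zeta)).

Definition gap_of (n : nat) : C := cis (INR (entry n 2) * mesh (entry n 1)).

Lemma step_fun_dense idx zeta0 (K : C -> Prop) phi g0 eps N0 :
  (forall m zeta, Cmod zeta = 1 ->
     Cmod (zeta - cis (INR (idx m zeta) * mesh m)) <= mesh m
     /\ (idx m zeta <= 8 * (m + 1))%nat) ->
  compactC K -> continuous_onC K phi -> (forall z, K z -> unit_circle z) ->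
  Cmod g0 = 1 -> ~ K g0 -> 0 < eps ->
  exists n, (N0 <= n)%nat /\ gap_of n <> zeta0 /\
    forall w, K w -> mesh (entry n 1) <= Cmod (w - gap_of n) /\
      forall zeta, Cmod zeta = 1 -> Cmod (zeta - w) <= mesh (entry n 1) ->
        Cmod (step_fun idx n zeta - phi w) <= eps.
Proof.
  intros Hidx HK Hphi HKT Hg0 HKg He.
  destruct (compactC_away K g0 HK HKg) as (k0 & Hk0 & Haway).
  destruct (compactC_uniform K phi (eps / 2) HK Hphi) as (d0 & Hd0 & Hunif); [lra|].
  (* [k0 / 2] keeps the gap one mesh away from [K]; [4 * mesh m] bounds the distance from [w] to the
     sample point of a cell, and [2 * mesh m] the rounding of its value. *)
  destruct (mesh_small (Rmin (k0 / 2) (Rmin (d0 / 4) (eps / 4)))) as [m Hm].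
  { repeat apply Rmin_pos; lra. }
  specialize (Hm m (le_n m)). assert (Hmp := mesh_pos m).
  assert (Hm1 : mesh m <= k0 / 2) by (apply Rle_trans with (1 := Hm), Rmin_l).
  assert (Hm2 : mesh m <= d0 / 4).
  { apply Rle_trans with (1 := Hm). eapply Rle_trans; [apply Rmin_r|apply Rmin_l]. }
  assert (Hm3 : mesh m <= eps / 4).
  { apply Rle_trans with (1 := Hm). eapply Rle_trans; [apply Rmin_r|apply Rmin_r]. }
  destruct (gap_direction m zeta0 g0 Hg0) as (a & Ha1 & Ha2).
  (* A cell near [K] takes a rounded value of [phi] at a sample point of [K] close by; the other
     cells are not met within one mesh of [K] and get the code 0. *)
  destruct (functional_choice (fun i k => (exists x, K x /\ Cmod (x - cis (INR i * mesh m)) <= 2 * mesh m) ->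
     exists x, K x /\ Cmod (x - cis (INR i * mesh m)) <= 2 * mesh m
            /\ Cmod (value m k - phi x) <= 2 * mesh m)) as [code Hcode].
  { intros i. destruct (Classical_Prop.classic
      (exists x, K x /\ Cmod (x - cis (INR i * mesh m)) <= 2 * mesh m)) as [(x & Hx1 & Hx2)|Hn].
    - destruct (value_approx m (phi x)) as [k Hk]. exists k. intros _. exists x. auto.
    - exists 0%nat. contradiction. }
  destruct (entry_surj (3 + 8 * (m + 1)) (fun i => match i with
     | O => N0 | 1%nat => m | 2%nat => a | S (S (S i')) => code i' end)) as [n Hn].
  assert (E0 : entry n 0 = N0) by (apply (Hn 0%nat); lia).
  assert (E1 : entry n 1 = m) by (apply (Hn 1%nat); lia).
  assert (E2 : entry n 2 = a) by (apply (Hn 2%nat); lia).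
  exists n. unfold gap_of, step_fun. rewrite E1, E2.
  split; [rewrite <- E0; apply entry_0_le|]. split; [trivial|].
  intros w Hw. split.
  - specialize (Haway w Hw).
    assert (G := Cmod_triangle_mid (cis (INR a * mesh m)) w g0). lra.
  - intros zeta Hz Hzw. destruct (Hidx m zeta Hz) as [Hi1 Hi2].
    set (i := idx m zeta) in *.
    rewrite (Hn (3 + i)%nat) by lia. change (3 + i)%nat with (S (S (S i))). cbv iota beta.
    destruct (Hcode i) as (x & Hx1 & Hx2 & Hx3).
    { exists w. split; trivial.
      assert (G := Cmod_triangle_mid zeta w (cis (INR i * mesh m))).
      rewrite (Cmod_minus_sym w zeta) in G. lra. }
    assert (Hxw : Cmod (x - w) <= d0).
    { assert (G := Cmod_triangle_mid (cis (INR i * mesh m)) x w).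
      assert (G2 := Cmod_triangle_mid zeta (cis (INR i * mesh m)) w).
      rewrite (Cmod_minus_sym (cis _) zeta) in G2. lra. }
    specialize (Hunif x w Hx1 Hw Hxw).
    assert (G := Cmod_triangle_mid (phi x) (value m (code i)) (phi w)). lra.
Qed.

Lemma increasing_selection (P : nat -> nat -> Prop) :
  (forall k N, exists m, (N <= m)%nat /\ P k m) ->
  exists nk : nat -> nat, (forall k, (nk k < nk (S k))%nat) /\ forall k, P k (nk k).
Proof.
  intros H.
  destruct (functional_choice (fun (x : nat * nat) m => (snd x <= m)%nat /\ P (fst x) m)) as [F HF].
  { intros [k N]. apply H. }
  exists (fix nk k := match k with O => F (0, 0)%nat | S k' => F (S k', S (nk k')) end).
  split.
  - intros k. apply (HF (S k, S _)).
  - intros [|k]; apply (HF (_, _)).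
Qed.

Theorem theorem3p9
  (rho : nat -> R)
  (Hrho_range : forall n, 0 <= rho n < 1)
  (Hrho_incr : forall n, rho n < rho (S n))
  (Hrho_lim : is_lim_seq rho 1)
  (w : R -> R)
  (Hw_cont : forall x, 0 <= x < 1 ->
     filterlim w (within (fun y => 0 <= y < 1) (locally x)) (locally (w x)))
  (Hw_ge1 : forall x, 0 <= x < 1 -> 1 <= w x)
  (Hw_incr : forall x y, 0 <= x -> x < y -> y < 1 -> w x < w y)
  (Hw_lim : filterlim w (at_left 1) (Rbar_locally p_infty))
  (A : C -> Prop)
  (HA_disc : forall z, A z -> unit_disc z)
  (HA_one : exists! zeta : C, closureC A zeta /\ unit_circle zeta) :
  exists f : C -> C, U_A rho f /\ forall z, A z -> Cmod (f z) <= w (Cmod z).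
Proof.
  destruct HA_one as (zeta0 & [_ Hz0] & Huniq). unfold unit_circle in Hz0.
  assert (Hcap := accumulation_point A HA_disc zeta0
    (fun z H1 H2 => eq_sym (Huniq z (conj H1 H2)))).
  destruct (functional_choice (fun m (ix : C -> nat) => forall zeta, Cmod zeta = 1 ->
     Cmod (zeta - cis (INR (ix zeta) * mesh m)) <= mesh m /\ (ix zeta <= 8 * (m + 1))%nat)
     circle_net) as [idx Hidx].
  (* A step function reads only finitely many entries of its code, one for each cell index, hence is
     bounded. *)
  destruct (functional_choice (fun n V => forall zeta, Cmod zeta = 1 ->
     Cmod (step_fun idx n zeta) <= V)) as [V HV].
  { intros n. destruct (finite_bound (fun i => Cmod (value (entry n 1) (entry n (3 + i))))
      (8 * (entry n 1 + 1))) as [V HV].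
    exists V. intros zeta Hz. apply (HV (idx (entry n 1) zeta)). apply Hidx. trivial. }
  destruct (universal_function rho A zeta0 w (step_fun idx) V gap_of
      (fun n => mesh (entry n 1)) (fun n => mesh (entry n 1)))
    as (f & Hf1 & Hf2 & Hf3); trivial.
  { intros n. apply Cmod_cis. }
  { intros n. apply mesh_pos. }
  { intros n. apply mesh_pos. }
  exists f. split; [split; [trivial|]|trivial].
  intros K phi HK HKT (g0 & Hg0 & HKg) Hphi. unfold unit_circle in Hg0.
  destruct (increasing_selection (fun k m => forall z, K z ->
     Cmod (dilate f (rho m) z - phi z) <= mesh k)) as (nk & Hnk1 & Hnk2).
  { intros k N0. assert (Hk := mesh_pos k).
    (* The budget in eighths of [mesh k]: two for the oscillation of the step function, two for the
       error of the construction, one for the distance from [phi]. *)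
    destruct (half_pow_small (mesh k / 8)) as [N1 HN1]; [lra|].
    destruct (step_fun_dense idx zeta0 K phi g0 (mesh k / 8) (Nat.max N0 N1))
      as (n & Hn & Hgn & Happ); trivial; [lra|].
    destruct (Hf3 n Hgn) as (m & Hm & Hm2).
    exists m. split; [lia|]. intros z Hz.
    destruct (Happ z Hz) as [Hz1 Hz2]. assert (HzT := HKT z Hz). unfold unit_circle in HzT.
    assert (Hzz : Cmod (step_fun idx n z - phi z) <= mesh k / 8).
    { apply Hz2; trivial. replace (z - z)%C with (RtoC 0) by ring. rewrite Cmod_0.
      apply Rlt_le, mesh_pos. }
    (* The comparison constant is the value of the step function at [z], for which the bound [V n]
       holds; within one mesh of [z] that function changes by at most twice [mesh k / 8]. *)
    assert (G := Hm2 z (step_fun idx n z) (mesh k / 4) HzT Hz1 (HV n z HzT)).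
    assert (G2 : Cmod (f (RtoC (rho m) * z)%C - step_fun idx n z)
                 <= mesh k / 4 + 2 * (/ 2) ^ n).
    { apply G. intros zeta Hzeta Hzz2. specialize (Hz2 zeta Hzeta Hzz2).
      assert (T := Cmod_triangle_mid (phi z) (step_fun idx n zeta) (step_fun idx n z)).
      rewrite (Cmod_minus_sym (phi z) (step_fun idx n z)) in T. lra. }
    specialize (HN1 n ltac:(lia)). unfold dilate.
    assert (T := Cmod_triangle_mid (step_fun idx n z) (f (RtoC (rho m) * z)%C) (phi z)).
    lra. }
  exists nk. split; [trivial|]. intros eps He.
  destruct (mesh_small eps He) as [k0 Hk0]. exists k0. intros k Hk z Hz.
  apply Rle_trans with (mesh k); [apply Hnk2; trivial|apply Hk0; trivial].
Qed.
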